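(* Let $d\ge 2$. There exists a constant $C>0$ such that, for every positive integer $n$, $$\sup_{x\in\mathbb{Z}^d} \mathsf{P}_{\mathsf{SAW}_n}\big(\Gamma_{\lfloor n/2\rfloor} = x\big) \leq C\, n^{-1/2}.$$
   Context: A walk of length $n$ is a map $\gamma:\{0,\dots,n\}\to\mathbb{Z}^d$ such that $\gamma_i$ and $\gamma_{i+1}$ are nearest neighbours in $\mathbb{Z}^d$ for each $0\le i\le n-1$; it is self-avoiding if it is injective. $\mathrm{SAW}_n$ is the (finite) set of self-avoiding walks of length $n$ with $\gamma_0=0$, $\mathsf{P}_{\mathsf{SAW}_n}$ is the uniform probability measure on $\mathrm{SAW}_n$, and $\Gamma$ denotes the random walk with law $\mathsf{P}_{\mathsf{SAW}_n}$. *)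

(* Defs.v *)
From HB Require Import structures.
From mathcomp Require Import all_boot all_order all_algebra.
From mathcomp Require Import finmap zify.
From mathcomp Require Import all_classical all_reals.
Set Implicit Arguments.
Unset Strict Implicit.
Unset Printing Implicit Defensive.
Import Order.TTheory GRing.Theory Num.Theory.
Local Open Scope classical_set_scope.
Local Open Scope ring_scope.

Definition nearest_neighbours (d : nat) (x y : 'rV[int]_d) : Prop :=
  \sum_(j < d) `|x 0 j - y 0 j| = 1.

(* [inord k : 'I_n.+1] has value [k] whenever [k <= n], as is the case at
   each of its occurrences below. *)
Definition is_walk (d n : nat) (g : {ffun 'I_n.+1 -> 'rV[int]_d}) : Prop :=
  forall i : nat, (i < n)%N -> nearest_neighbours (g (inord i)) (g (inord i.+1)).

Definition SAW (d n : nat) : set {ffun 'I_n.+1 -> 'rV[int]_d} :=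
  [set g | [/\ is_walk g, injective g & g ord0 = 0]].
Arguments SAW : clear implicits.

Lemma finite_SAW (d n : nat) : finite_set (SAW d n).
Proof.
pose F (h : {ffun 'I_n.+1 -> 'rV['I_(n + n).+1]_d}) :
    {ffun 'I_n.+1 -> 'rV[int]_d} :=
  [ffun i => \row_j ((h i 0 j : nat)%:Z - n%:Z)].
apply: (@sub_finite_set _ _ (F @` setT)); last first.
  by apply: finite_image; exact: finite_finset.
move=> g [gw _ g0].
have bnd k j : (k <= n)%N -> `|g (inord k) 0 j| <= k%:Z.
  elim: k => [_|k IH kn].
    have -> : inord 0 = ord0 :> 'I_n.+1 by apply: val_inj; rewrite /= inordK.
    by rewrite g0 mxE normr0.
  have le1 : `|g (inord k) 0 j - g (inord k.+1) 0 j| <= 1.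
    by rewrite -(gw k kn) (bigD1 j) //= lerDl sumr_ge0.
  rewrite distrC in le1; rewrite -(subrK (g (inord k) 0 j) (g (inord k.+1) 0 j)).
  rewrite intS; apply: le_trans (ler_normD _ _) _.
  exact: lerD le1 (IH (ltnW kn)).
exists [ffun i => \row_j inord (absz (g i 0 j + n%:Z))] => //.
apply/ffunP => i; rewrite !ffunE; apply/rowP => j; rewrite !mxE.
have ilen : (i <= n)%N by rewrite -ltnS.
have := bnd i j ilen; rewrite inord_val ler_norml.
move: (g i 0 j) => z /andP[zl zu].
have -> : z = (absz (z + n%:Z))%:Z - n%:Z by lia.
by rewrite !subrK absz_nat inordK //; lia.
Qed.

Lemma SAW_nonempty (d n : nat) : (0 < d)%N -> SAW d n !=set0.
Proof.
case: d => // d _.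
exists [ffun i : 'I_n.+1 => \row_j (if j == 0 then (i : nat)%:Z else 0)].
split.
- move=> i iltn; rewrite /nearest_neighbours big_ord_recl !ffunE !mxE /=.
  rewrite big1 ?addr0; last by move=> j _; rewrite !mxE /= subrr normr0.
  by rewrite !inordK; lia.
- move=> a b /rowP /(_ 0); rewrite !ffunE !mxE /= => -[ab].
  exact: val_inj.
- by rewrite ffunE; apply/rowP => j; rewrite !mxE; case: eqP.
Qed.

(* Meaningful for finite nonempty [S]; [SAW d n] is such a set by the two
   lemmas above when [0 < d]. *)
Definition uniform_law (R : realType) (T : choiceType) (S A : set T) : R :=
  #|` fset_set (S `&` A) |%:R / #|` fset_set S |%:R.

Definition P_SAW (R : realType) (d n : nat)
    (A : set {ffun 'I_n.+1 -> 'rV[int]_d}) : R :=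
  uniform_law R (SAW d n) A.
Arguments P_SAW R {d n} A.

(* Main.v *)
Require Import Defs.
From HB Require Import structures.
From mathcomp Require Import all_boot all_order all_algebra finmap.
From mathcomp Require Import all_classical all_reals.
From mathcomp Require Import ereal sequences exp zify ring lra.
Import Order.TTheory GRing.Theory Num.Theory.
Local Open Scope ring_scope.

(* Call a detour x - u - v - y of the walk with x adjacent to y a U-turn; it can be
   cut off, and conversely an edge x - y is a free slot if such a detour can be
   inserted there. Suppose that a typical walk has of order n U-turns and of
   order n free slots in each half. Fix x and a walk at x at time n/2. Inserting
   a detour before x and cutting one off after x gives a walk of the same length
   at x at time n/2 + 2, and the numbers of such moves out of and into a walk
   vary slowly. Hence either these moves or the opposite ones, iterated t <= sqrt n
   times, lose only a bounded factor in the number of walks, and the events of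
   being at x at the times n/2 + 2t are disjoint; this gives the bound n^(-1/2).

   Walks with few U-turns are exponentially rare by a version of Kesten's pattern
   theorem: consider 3 x 2 grids (ladders). If all the visits of a walk to a
   ladder, at least two in number, occur within a bounded time window, the part in
   between can be rerouted inside the ladder to make a U-turn; doing this at many
   places multiplies the number of walks unless U-turns were already frequent.
   By induction on k, a typical walk with few U-turns visits many ladders k times,
   as otherwise many ladders visited k times by a short piece are not visited by
   the rest of the walk; k = 7 is absurd. Given many U-turns, cutting them off
   shows in the same way that free slots are frequent. *)

Set Implicit Arguments.
Unset Strict Implicit.
Unset Printing Implicit Defensive.

(** * Double counting along moves *)

(** An insertion is paired with a removal so that all the walks compared have the same length:
    nothing has to be known about the ratio of the numbers of walks of lengths [n] and [n + 2]. The
    only growth estimates are [mu ^ n <= cn n] and upper bounds on [cn n] with every rate above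
    [mu]. Together they make an event counted with some rate below [mu] negligible, even after
    multiplication by [n], and this is the only notion of rarity below. The three kinds of moves
    (rerouting in a ladder, cutting off a U-turn, transfer) obey the same count: a move leaves a
    code by which it can be undone, and only the ratio of the number of codes at the target to the
    number of moves at the source matters. The argument is carried out in an abelian group with a
    list of directions. The lattice enters through four properties: the directions are closed under
    negation, omit 0, each spans a ladder with another one, and walks of every length exist. *)

Lemma double_count (R : realType) (W M K : eqType) (moves : W -> seq M)
    (codes : W -> seq K) (step : W -> M -> W -> K -> Prop) (A : seq W) (lam : R) :
  uniq A ->
  (forall w, w \in A -> uniq (moves w)) ->
  (forall w, w \in A -> moves w != [::]) ->
  (forall w m, w \in A -> m \in moves w -> exists w' k,
    [/\ step w m w' k, k \in codes w' &
        (size (codes w'))%:R <= lam * (size (moves w))%:R]) ->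
  (forall w1 m1 w2 m2 w' k, step w1 m1 w' k -> step w2 m2 w' k ->
    w1 = w2 /\ m1 = m2) ->
  exists B : seq W, [/\ uniq B, (size A)%:R <= lam * (size B)%:R &
    forall w', w' \in B -> exists w m k,
      [/\ w \in A, m \in moves w & step w m w' k]].
Proof.
move=> uA umv mv0 mvP inj.
case: A uA umv mv0 mvP => [|w0 A'].
  by exists [::]; split => //=; rewrite mulr0.
set A := w0 :: A' => uA umv mv0 mvP.
have w0A : w0 \in A by rewrite inE eqxx.
have [m0 m0P] : exists m, m \in moves w0.
  by case: (moves w0) (mv0 _ w0A) => // m l _; exists m; rewrite inE eqxx.
have [wd [kd _]] := mvP _ _ w0A m0P.
have [h hP] : {h : W * M -> W * K & forall p, p.1 \in A -> p.2 \in moves p.1 ->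
    [/\ step p.1 p.2 (h p).1 (h p).2, (h p).2 \in codes (h p).1 &
        (size (codes (h p).1))%:R <= lam * (size (moves p.1))%:R]}.
  apply: (@choice _ _ (fun p q => p.1 \in A -> p.2 \in moves p.1 ->
    [/\ step p.1 p.2 q.1 q.2, q.2 \in codes q.1 &
        (size (codes q.1))%:R <= lam * (size (moves p.1))%:R])) => -[w m] /=.
  case wA: (w \in A); last by exists (wd, kd).
  case mw: (m \in moves w); last by exists (wd, kd).
  by have [w' [k H]] := mvP _ _ wA mw; exists (w', k).
pose E := [seq (w, m) | w <- A, m <- moves w].
have memE p : p \in E -> p.1 \in A /\ p.2 \in moves p.1.
  by move=> /allpairsPdep[w [m [wA mw ->]]].
have uE : uniq E.
  by apply: allpairs_uniq_dep => // -[w m] [w' m'] _ _ [-> ->].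
pose B := undup [seq (h p).1 | p <- E].
exists B; split; first exact: undup_uniq.
  have sA : (size A)%:R = \sum_(p <- E) (size (moves p.1))%:R^-1 :> R.
    rewrite big_allpairs_dep /=.
    have -> : (size A)%:R = \sum_(w <- A) 1 :> R.
      by rewrite big_const_seq count_predT iter_addr_0.
    rewrite [LHS]big_seq [RHS]big_seq.
    apply: eq_bigr => w wA; rewrite big_const_seq count_predT iter_addr_0.
    rewrite -[RHS]mulr_natl mulfV // pnatr_eq0 size_eq0; exact: mv0.
  have -> : lam * (size B)%:R = \sum_(b <- B) lam.
    by rewrite big_const_seq count_predT iter_addr_0 mulr_natr.
  rewrite sA.
  have le1 : \sum_(p <- E) (size (moves p.1))%:R^-1 <=
      \sum_(p <- E) lam / (size (codes (h p).1))%:R.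
    rewrite big_seq [leRHS]big_seq; apply: ler_sum => p /memE[pA pm].
    have [_ kc le] := hP _ pA pm.
    have mgt : 0 < (size (moves p.1))%:R :> R.
      by rewrite ltr0n lt0n size_eq0; exact: mv0.
    have cgt : 0 < (size (codes (h p).1))%:R :> R.
      by rewrite ltr0n; case: (codes _) kc.
    rewrite ler_pdivlMr // mulrC ler_pdivrMr //.
  apply: le_trans le1 _.
  have -> : \sum_(p <- E) lam / (size (codes (h p).1))%:R =
      \sum_(b <- B) \sum_(p <- E | (h p).1 == b) lam / (size (codes b))%:R.
    rewrite (exchange_big_dep predT) //= big_seq [RHS]big_seq.
    apply: eq_bigr => p pE; have pB : (h p).1 \in B.
      by rewrite mem_undup; apply: map_f.
    rewrite big_mkcond (bigD1_seq (h p).1) ?undup_uniq //= eqxx big1 ?addr0 //.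
    by move=> b bp; rewrite eq_sym (negbTE bp).
  rewrite big_seq [leRHS]big_seq; apply: ler_sum => b.
  rewrite mem_undup => /mapP[p0 p0E bE].
  have [p0A p0m] := memE _ p0E.
  have [_ kc le] := hP _ p0A p0m.
  rewrite -bE in kc le.
  have cgt : 0 < (size (codes b))%:R :> R by rewrite ltr0n; case: (codes _) kc.
  have mgt : 0 < (size (moves p0.1))%:R :> R.
    by rewrite ltr0n lt0n size_eq0; exact: mv0.
  have lam0 : 0 <= lam.
    by rewrite -(pmulr_lge0 _ mgt); apply: le_trans le; exact: ltW.
  rewrite big_const_seq iter_addr_0 -[leLHS]mulr_natr -mulrA ler_piMr // mulrC.
  rewrite ler_pdivrMr // mul1r ler_nat -size_filter.
  (* The pairs sent to [b] have different codes, since target and code determine the pair; hence at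
     most #codes of them end in [b]. *)
  rewrite -(size_map (fun p => (h p).2)); apply: uniq_leq_size.
    rewrite map_inj_in_uniq ?filter_uniq // => p q.
    rewrite !mem_filter => /andP[/eqP pb pE] /andP[/eqP qb qE] epq.
    have [pA pm] := memE _ pE; have [qA qm] := memE _ qE.
    have [s1 _ _] := hP _ pA pm; have [s2 _ _] := hP _ qA qm.
    rewrite pb in s1; rewrite qb -epq in s2.
    have [] := inj _ _ _ _ _ _ s1 s2.
    by move: p q {pb pE qb qE epq pA pm qA qm s1 s2} => [? ?] [? ?] /= -> ->.
  move=> k /mapP[p]; rewrite mem_filter => /andP[/eqP pb pE] ->.
  have [pA pm] := memE _ pE.
  by have [_] := hP _ pA pm; rewrite pb.
move=> w'; rewrite mem_undup => /mapP[p pE ->].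
have [pA pm] := memE _ pE; have [s1 _ _] := hP _ pA pm.
by exists p.1, p.2, (h p).2.
Qed.

(** The image of one level is the starting set of the next. [Inv t] may weaken with [t], because the
    numbers of moves and codes drift as the walk is changed. *)
Lemma double_count_iter (R : realType) (W M K : eqType) (moves : W -> seq M)
    (codes : W -> seq K) (step : W -> M -> W -> K -> Prop)
    (Inv : nat -> W -> Prop) (lam : R) (s : nat) :
  (forall t w, (t < s)%N -> Inv t w -> uniq (moves w)) ->
  (forall t w, (t < s)%N -> Inv t w -> moves w != [::]) ->
  (forall t w m, (t < s)%N -> Inv t w -> m \in moves w -> exists w' k,
    [/\ step w m w' k, k \in codes w' &
        (size (codes w'))%:R <= lam * (size (moves w))%:R]) ->
  (forall t w m w' k, (t < s)%N -> Inv t w -> m \in moves w ->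
    step w m w' k -> Inv t.+1 w') ->
  (forall w1 m1 w2 m2 w' k, step w1 m1 w' k -> step w2 m2 w' k ->
    w1 = w2 /\ m1 = m2) ->
  0 <= lam ->
  forall A : seq W, uniq A -> (forall w, w \in A -> Inv 0 w) ->
  forall t, (t <= s)%N -> exists B : seq W,
    [/\ uniq B, (size A)%:R <= lam ^+ t * (size B)%:R &
        forall w, w \in B -> Inv t w].
Proof.
move=> umv mv0 mvP pres inj lam0 A uA A0; elim=> [|t IH] ts.
  by exists A; split => //; rewrite expr0 mul1r.
have [B [uB leB BP]] := IH (ltnW ts).
have [|||B' [uB' leB' B'P]] := @double_count R W M K moves codes step B lam uB _ _ _ inj.
- by move=> w /BP; exact: umv.
- by move=> w /BP; exact: mv0.
- by move=> w m /BP Iw; exact: mvP Iw.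
exists B'; split => //.
  rewrite exprSr -mulrA; apply: le_trans leB _.
  by rewrite ler_wpM2l // exprn_ge0.
by move=> w' /B'P[w [m [k [/BP Iw mw st]]]]; exact: pres Iw mw st.
Qed.

(** * Self-avoiding walks *)

Lemma ler_sum_sub (R : realType) (T : eqType) (E F : seq T) (h : T -> R) :
  uniq E -> uniq F -> {subset E <= F} -> (forall t, 0 <= h t) ->
  \sum_(t <- E) h t <= \sum_(t <- F) h t.
Proof.
move=> uE uF EF h0; rewrite [leRHS](bigID (mem E)) /=.
rewrite -[leLHS]addr0; apply: lerD; last exact: sumr_ge0.
rewrite -[leRHS]big_filter le_eqVlt; apply/orP; left; apply/eqP.
apply/perm_big/uniq_perm => //; first exact: filter_uniq.
by move=> p; rewrite mem_filter /=; case pE: (p \in E) => //=; rewrite EF.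
Qed.

Section Walks.
Variables (V : zmodType) (dirs : seq V).
Implicit Types (x y : V) (w p : seq V).

Definition adj x y := y - x \in dirs.

Definition saw w := uniq w && sorted adj w.

Fixpoint paths x n : seq (seq V) :=
  if n is n'.+1 then
    [seq x :: p | p <- flatten [seq paths (x + a) n' | a <- dirs]]
  else [:: [:: x]].

Definition saws n := [seq w <- paths 0 n | uniq w].

Definition cn n := size (saws n).

Lemma size_paths x n : size (paths x n) = (size dirs ^ n)%N.
Proof.
elim: n x => //= n IH x; rewrite size_map size_flatten /shape -map_comp.
rewrite expnS; elim: {1 2}dirs => //= a l ->; by rewrite IH mulSn.
Qed.

Lemma mem_paths x n p :
  (p \in paths x n) = [&& size p == n.+1, head (0 : V) p == x & sorted adj p].
Proof.
elim: n x p => [|n IH] x p /=.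
  rewrite inE; case: p => [|y [|z p]] //=; rewrite /eq_op /= ?andbT ?andbF //.
apply/mapP/idP.
  move=> [q /flattenP[s /mapP[a ad ->]] + ->]; rewrite IH.
  case: q => //= y q /and3P[/eqP -> /eqP yE srt].
  by rewrite !eqxx /= srt andbT /adj yE addrAC subrr add0r.
case: p => // y [|z p] //= /and3P[/eqP[sz] /eqP -> /andP[axz srt]].
exists (z :: p) => //; apply/flattenP; exists (paths z n); last first.
  by rewrite IH /= eqxx srt sz eqxx.
by apply/mapP; exists (z - x); rewrite // addrC subrK.
Qed.

Lemma uniq_paths x n : uniq dirs -> uniq (paths x n).
Proof.
move=> ud; elim: n x => //= n IH x.
rewrite map_inj_uniq; last by move=> p q [].
elim: dirs ud => //= a l IHl /andP[al ul].
rewrite cat_uniq IH IHl // ?andbT /=.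
apply/hasPn => p /flattenP[s /mapP[b bl ->]].
rewrite !mem_paths => /and3P[_ /eqP -> _]; apply/negP => /and3P[_ /eqP ba _].
by move/addrI: ba => ba; rewrite -ba bl in al.
Qed.

Lemma mem_saws n w :
  (w \in saws n) = [&& size w == n.+1, head (0 : V) w == 0 & saw w].
Proof. by rewrite mem_filter mem_paths /saw andbC -!andbA; do !bool_congr. Qed.

Lemma uniq_saws n : uniq dirs -> uniq (saws n).
Proof. by move=> ud; rewrite filter_uniq // uniq_paths. Qed.

Definition shift w := [seq x - head (0 : V) w | x <- w].

Lemma adjD z x y : adj (x + z) (y + z) = adj x y.
Proof. by rewrite /adj opprD addrACA subrr addr0. Qed.

Lemma adjxx x : adj x x = (0 \in dirs).
Proof. by rewrite /adj subrr. Qed.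

Lemma adj_step x c : c \in dirs -> adj x (x + c).
Proof. by rewrite /adj addrC addKr. Qed.

Lemma sorted_translate z w : sorted adj [seq x + z | x <- w] = sorted adj w.
Proof. by rewrite sorted_map; apply: eq_sorted => x y /=; exact: adjD. Qed.

Lemma saw_shift z w : saw [seq x + z | x <- w] = saw w.
Proof. by rewrite /saw sorted_translate map_inj_uniq //; exact: addIr. Qed.

Lemma size_shift w : size (shift w) = size w.
Proof. exact: size_map. Qed.

Lemma head_shift w : head (0 : V) (shift w) = 0.
Proof. by case: w => //= x w; rewrite subrr. Qed.

Lemma saw_cat w1 w2 : saw (w1 ++ w2) -> saw w1 /\ saw w2.
Proof.
rewrite /saw cat_uniq => /andP[/and3P[-> _ ->]].
by move=> /cat_sorted2[-> ->].
Qed.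

Lemma saw_take n w : saw w -> saw (take n w).
Proof. by rewrite -{1}(cat_take_drop n w) => /saw_cat[]. Qed.

Lemma saw_drop n w : saw w -> saw (drop n w).
Proof. by rewrite -{1}(cat_take_drop n w) => /saw_cat[]. Qed.

Lemma take_saws m n w : w \in saws (m + n) -> take m.+1 w \in saws m.
Proof.
rewrite !mem_saws => /and3P[/eqP sw hw /saw_take ->].
rewrite size_take sw andbT; apply/andP; split; last by case: w hw {sw}.
by apply/eqP; case: ltnP; lia.
Qed.

Lemma drop_saws m n w : w \in saws (m + n) -> shift (drop m w) \in saws n.
Proof.
rewrite !mem_saws size_shift head_shift eqxx => /and3P[/eqP sw hw sww].
by rewrite saw_shift saw_drop // size_drop sw; apply/andP; split => //; lia.
Qed.

Lemma head_drop m w : head (0 : V) (drop m w) = nth (0 : V) w m.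
Proof. by rewrite -nth0 nth_drop addn0. Qed.

(** Both parts contain the vertex number [m], so the first part tells by how much the second one was
    translated. *)
Lemma cut_inj m n w1 w2 : w1 \in saws (m + n) -> w2 \in saws (m + n) ->
  take m.+1 w1 = take m.+1 w2 -> shift (drop m w1) = shift (drop m w2) ->
  w1 = w2.
Proof.
rewrite !mem_saws => /and3P[/eqP s1 _ _] /and3P[/eqP s2 _ _] et.
have em : nth (0 : V) w1 m = nth (0 : V) w2 m.
  by rewrite -(nth_take 0 (ltnSn m) w1) et nth_take.
rewrite /shift !head_drop em => /(inj_map (addIr _)) ed.
rewrite -(cat_take_drop m w1) -(cat_take_drop m w2) ed; congr (_ ++ _).
by rewrite -(take_takel w1 (leqnSn m)) et take_takel.
Qed.

(** Submultiplicativity with weights: cutting is injective into pairs of walks. The weights serve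
    for exponential moments and for events that concern one half of a walk. *)
Lemma sum_cut (R : realType) (m n : nat) (f g : seq V -> R) : uniq dirs ->
  (forall w, 0 <= f w) -> (forall w, 0 <= g w) ->
  \sum_(w <- saws (m + n)) f (take m.+1 w) * g (shift (drop m w)) <=
  (\sum_(w <- saws m) f w) * (\sum_(w <- saws n) g w).
Proof.
move=> ud f0 g0.
have -> : (\sum_(w <- saws m) f w) * (\sum_(w <- saws n) g w) =
   \sum_(p <- [seq (u, v) | u <- saws m, v <- saws n]) f p.1 * g p.2.
  rewrite big_allpairs_dep /= mulr_suml; apply: eq_bigr => u _.
  by rewrite mulr_sumr.
have -> : \sum_(w <- saws (m + n)) f (take m.+1 w) * g (shift (drop m w)) =
    \sum_(p <- [seq (take m.+1 w, shift (drop m w)) | w <- saws (m + n)])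
      f p.1 * g p.2 by rewrite big_map.
set E := map _ _; set F := [seq _ | _ <- _, _ <- _].
have uE : uniq E.
  rewrite map_inj_in_uniq ?uniq_saws // => w1 w2 w1s w2s [et ed].
  exact: (cut_inj w1s w2s).
have uF : uniq F.
  by apply: allpairs_uniq; rewrite ?uniq_saws // => -[? ?] [? ?] _ _ [-> ->].
have EF : {subset E <= F}.
  move=> p /mapP[w ws ->]; apply/allpairsPdep.
  exists (take m.+1 w), (shift (drop m w)); split => //.
  - exact: take_saws ws.
  - exact: drop_saws.
by apply: ler_sum_sub => // p; rewrite mulr_ge0.
Qed.

Lemma cn_cut (R : realType) m n : uniq dirs ->
  (cn (m + n))%:R <= (cn m)%:R * (cn n)%:R :> R.
Proof.
move=> ud; have E k : (cn k)%:R = \sum_(w <- saws k) 1 :> R.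
  by rewrite big_const_seq count_predT iter_addr_0.
rewrite !E; apply: le_trans (sum_cut m n (f := fun=> 1) (g := fun=> 1) _ _ _) => //.
by rewrite mulr1.
Qed.

Lemma cn_dirs n : (cn n <= size dirs ^ n)%N.
Proof. by rewrite -(size_paths 0) /cn /saws size_filter count_size. Qed.

Lemma adj_sym : (forall a, a \in dirs -> - a \in dirs) -> symmetric adj.
Proof.
move=> dN x y; apply/idP/idP; rewrite /adj => /dN; by rewrite opprB.
Qed.

Lemma saw_rev w : (forall a, a \in dirs -> - a \in dirs) -> saw (rev w) = saw w.
Proof.
move=> dN; rewrite /saw rev_uniq rev_sorted; congr (_ && _).
by apply: eq_sorted => x y /=; rewrite adj_sym.
Qed.

End Walks.

(** * The connective constant *)

Lemma bernoulli (R : realType) (t : R) (n : nat) : 0 <= t <= 1 ->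
  1 - n%:R * t <= (1 - t) ^+ n.
Proof.
move=> /andP[t0 t1]; elim: n => [|n IH]; first by rewrite mul0r subr0 expr0.
rewrite exprSr; have := ler_wpM2r (_ : 0 <= 1 - t) IH.
rewrite subr_ge0 => /(_ t1); apply: le_trans.
have : 0 <= n%:R * t ^+ 2 by rewrite mulr_ge0 ?sqr_ge0.
rewrite -natr1; lra.
Qed.

Lemma bernoulli_up (R : realType) (t : R) (n : nat) : 0 <= t ->
  1 + n%:R * t <= (1 + t) ^+ n.
Proof.
move=> t0; elim: n => [|n IH]; first by rewrite mul0r addr0 expr0.
rewrite exprSr; have := ler_wpM2r (_ : 0 <= 1 + t) IH.
rewrite addr_ge0 // => /(_ isT); apply: le_trans.
have : 0 <= n%:R * t ^+ 2 by rewrite mulr_ge0 ?sqr_ge0.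
rewrite -natr1; lra.
Qed.

(** A substitute for the [k]-th root of [r], by Bernoulli's inequality. The maximum with 1/2 keeps
    [q] positive when [r] is not, and [k.+1] covers [k = 0]. *)
Lemma near_one_root (R : realType) (r : R) (k : nat) : r < 1 ->
  exists2 q : R, 0 < q < 1 & r <= q ^+ k.
Proof.
move=> r1; pose s := Num.max r (2^-1).
have s1 : s < 1 by rewrite gt_max r1 /=; lra.
have s0 : 0 < s by rewrite lt_max invr_gt0 ltr0n orbT.
have k0 : 0 < k.+1%:R :> R by [].
have kge : 1 <= k.+1%:R :> R by rewrite ler1n.
pose t := (1 - s) / k.+1%:R.
have t0 : 0 < t by rewrite divr_gt0 ?subr_gt0.
have t1 : t < 1.
  rewrite ltr_pdivrMr // mul1r; apply: lt_le_trans kge; lra.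
exists (1 - t); first by apply/andP; split; lra.
have rs : r <= s by rewrite le_max lexx.
apply: le_trans rs _; apply: le_trans (bernoulli k _); last by lra.
have : k.+1%:R * t = 1 - s by rewrite mulrC divfK // gt_eqF.
rewrite -natr1; lra.
Qed.

Lemma pow_le_small (R : realType) (q e : R) : 0 < q < 1 -> 0 < e ->
  exists n0, forall n, (n0 <= n)%N -> q ^+ n <= e.
Proof.
move=> /andP[q0 q1] e0; pose t := q^-1 - 1.
have t0 : 0 < t by rewrite subr_gt0 invf_gt1.
exists (Num.bound (e * t)^-1) => n.
move=> le_n; have n_big : (e * t)^-1 < n%:R.
  apply: lt_le_trans (_ : (Num.bound (e * t)^-1)%:R <= _); last by rewrite ler_nat.
  by apply: archi_boundP; rewrite invr_ge0 mulr_ge0 // ltW.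
have := bernoulli_up n (ltW t0).
rewrite (_ : 1 + t = q^-1) ?exprVn => [B|]; last by rewrite /t addrC subrK.
have qn0 : 0 < q ^+ n by rewrite exprn_gt0.
rewrite -(invrK (q ^+ n)) -[leRHS]invrK lef_pV2 ?posrE ?invr_gt0 //.
apply: le_trans B; rewrite -/t.
have : e^-1 < n%:R * t.
  by rewrite -ltr_pdivrMr // -invfM.
lra.
Qed.

(** Fekete's lemma with [mu] as the supremum of the rates [x] such that [x ^+ n <= c n] for all [n].
    A rate [theta] above [mu] fails at some length [m], and [c m < theta ^+ m] spreads to all
    lengths through division by [m]. *)
Lemma connective_constant (R : realType) (c : nat -> nat) :
  (forall n, (0 < c n)%N) ->
  (forall m n, (c (m + n)%N)%:R <= (c m)%:R * (c n)%:R :> R) ->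
  exists mu : R, [/\ 1 <= mu, forall n, mu ^+ n <= (c n)%:R &
    forall theta, mu < theta -> exists2 C, 0 < C &
      forall n, (c n)%:R <= C * theta ^+ n].
Proof.
move=> c0 csub.
pose S : set R := [set x | 0 <= x /\ forall n, x ^+ n <= (c n)%:R]%classic.
have S1 : S 1 by split => // n; rewrite expr1n ler1n.
have hsS : has_sup S.
  split; first by exists 1.
  by exists (c 1)%:R => x [_ /(_ 1%N)]; rewrite expr1.
exists (sup S); have mu1 : 1 <= sup S by apply: sup_ubound => //; case: hsS.
have mu0 : 0 < sup S by apply: lt_le_trans mu1.
split => //.
  move=> n; rewrite leNgt; apply/negP => lt.
  pose r : R := (c n)%:R / sup S ^+ n.
  have r1 : r < 1 by rewrite ltr_pdivrMr ?exprn_gt0 // mul1r.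
  (* Some admissible rate exceeds [sup S * q], and its [n]-th power would then exceed [c n]. *)
  have [q /andP[q0 q1] rq] := near_one_root n r1.
  have [|x [x0 xS] qx] := @sup_adherent _ S (sup S * (1 - q)) _ hsS.
    by rewrite mulr_gt0 // subr_gt0.
  have {}qx : sup S * q < x by move: qx; rewrite mulrBr mulr1 opprB addrCA subrr addr0.
  have n0 : n != 0%N.
    by apply: contraTneq lt => ->; rewrite expr0 -leNgt ler1n.
  have : (sup S * q) ^+ n < x ^+ n.
    by rewrite ltrXn2r ?n0 //; rewrite mulr_ge0 ?ltW.
  apply/negP; rewrite -leNgt; apply: le_trans (xS n) _.
  by rewrite exprMn mulrC -ler_pdivrMr ?exprn_gt0.
move=> theta mut.
have th0 : 0 < theta by apply: lt_trans mut.
have [m cm] : exists m, (c m)%:R < theta ^+ m.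
  apply: contrapT => H; have : S theta.
    split; [exact: ltW | move=> n; rewrite leNgt; apply/negP => lt].
    by apply: H; exists n.
  by move/(sup_ubound (proj2 hsS)); rewrite leNgt mut.
have m0 : (0 < m)%N.
  by rewrite lt0n; apply: contraTneq cm => ->; rewrite expr0 -leNgt ler1n.
have th1 : 1 <= theta by apply: le_trans (ltW mut).
pose C : R := \sum_(r < m) (c r)%:R.
exists (C + 1); first by rewrite ltr_wpDl // sumr_ge0.
have mul q r : (c (q * m + r)%N)%:R <= theta ^+ (q * m) * (c r)%:R.
  elim: q => [|q IH]; first by rewrite mul0n expr0 mul1r.
  rewrite mulSn -addnA; apply: le_trans (csub _ _) _.
  rewrite exprD -mulrA; apply: ler_pM => //; exact: ltW.
move=> n; rewrite {1}(divn_eq n m); apply: le_trans (mul _ _) _.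
have le_r : (c (n %% m)%N)%:R <= C + 1.
  apply: ler_wpDr => //; rewrite /C (bigD1 (Ordinal (ltn_pmod n m0))) //=.
  by rewrite lerDl sumr_ge0.
have le_q : theta ^+ (n %/ m * m) <= theta ^+ n.
  by rewrite ler_weXn2l // leq_divM.
by rewrite mulrC; apply: ler_pM => //; rewrite exprn_ge0 // ltW.
Qed.

(** * Multiplying walks by successive moves *)

Section Switching.
Variables (R : realType) (V : zmodType) (dirs : seq V).
Implicit Types (w : seq V).

Definition rooted_saw w := [&& w != [::], head (0 : V) w == 0 & saw dirs w].

Lemma saws_rooted n w : (w \in saws dirs n) = (size w == n.+1) && rooted_saw w.
Proof. by rewrite mem_saws /rooted_saw; case: w. Qed.

(** Moves change the length, so the walks obtained are spread over all lengths up to [N]; the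
    geometric sum costs only a constant factor. *)
Lemma size_rooted_le (mu : R) : 1 <= mu -> (forall theta, mu < theta ->
    exists2 C, 0 < C & forall n, (cn dirs n)%:R <= C * theta ^+ n) ->
  forall theta, mu < theta -> exists2 C, 0 < C & forall (N : nat) (B : seq (seq V)),
    uniq B -> (forall w, w \in B -> rooted_saw w /\ (size w <= N.+1)%N) ->
    (size B)%:R <= C * theta ^+ N.
Proof.
move=> mu1 up theta mut.
have [C C0 le] := up _ mut.
have th1 : 1 < theta by apply: le_lt_trans mut.
have th0 : 0 < theta - 1 by rewrite subr_gt0.
exists (C * (theta / (theta - 1))).
  by rewrite mulr_gt0 // divr_gt0 //; lra.
move=> N B uB BP.
have sub : (size B <= size (flatten [seq saws dirs k | k <- iota 0 N.+1]))%N.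
  apply: uniq_leq_size => // w /BP[rw sw].
  apply/flattenP; exists (saws dirs (size w).-1).
    apply/mapP; exists (size w).-1 => //.
    by rewrite mem_iota /=; case: (w) rw sw.
  by rewrite saws_rooted rw andbT; case: (w) rw.
apply: le_trans (_ : (size (flatten [seq saws dirs k | k <- iota 0 N.+1]))%:R <= _).
  by rewrite ler_nat.
have -> : C * (theta / (theta - 1)) * theta ^+ N =
    C * (theta ^+ N.+1 / (theta - 1)) by rewrite exprS; ring.
elim: N {B uB BP sub} => [|N IH].
  have le0 := le 0%N; rewrite expr0 mulr1 in le0; rewrite expr1.
  apply: le_trans le0 _; rewrite ler_peMr ?(ltW C0) // ler_pdivlMr //; lra.
rewrite -[in iota _ _]addn1 iotaD map_cat flatten_cat size_cat natrD.
rewrite -[flatten [seq _ | k <- iota (0 + N.+1) 1]]/(saws dirs N.+1 ++ [::]) cats0.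
apply: le_trans (lerD IH (le N.+1)) _.
rewrite -mulrDr ler_pM2l //.
rewrite -[X in _ + X](mulfK (lt0r_neq0 th0)) -mulrDl ler_pM2r ?invr_gt0 //.
rewrite [leRHS]exprS; lra.
Qed.

(* Each of the many moves leaves a mark that allows it to be undone, while marks
   are few. So one move multiplies the number of walks by a large factor, and
   [s] successive moves, [s] being a small multiple of [n], change the length
   by [O(s)] and gain that factor to the power [s]. *)
Lemma switching (mu : R) : 1 <= mu -> (forall theta, mu < theta ->
    exists2 C, 0 < C & forall n, (cn dirs n)%:R <= C * theta ^+ n) ->
  uniq dirs ->
  forall (tau : R) (K1 K2 Kc G : nat), 0 < tau ->
  exists (eps C rho : R) (n0 : nat), [/\ 0 < eps, 0 < C, 0 < rho < mu &
  forall (M K : eqType) (moves : seq V -> seq M) (codes : seq V -> seq K)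
    (step : seq V -> M -> seq V -> K -> Prop) (mark : seq V -> nat),
  (forall w, rooted_saw w -> uniq (moves w)) ->
  (forall w, (size (codes w) <= Kc * mark w)%N) ->
  (forall w m, rooted_saw w -> m \in moves w ->
    exists w' k, step w m w' k /\ k \in codes w') ->
  (forall w m w' k, rooted_saw w -> m \in moves w -> step w m w' k ->
    [/\ rooted_saw w', (size w' <= size w + G)%N,
        (size (moves w) <= size (moves w') + K1)%N &
        (mark w' <= mark w + K2)%N]) ->
  (forall w1 m1 w2 m2 w' k, step w1 m1 w' k -> step w2 m2 w' k ->
    w1 = w2 /\ m1 = m2) ->
  forall n, (n0 <= n)%N ->
  (count (fun w => ((mark w)%:R < eps * n%:R) && (tau * n%:R <= (size (moves w))%:R))
    (saws dirs n))%:R <= C * rho ^+ n].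
Proof.
move=> mu1 up ud tau K1 K2 Kc G tau0.
have mu0 : 0 < mu by apply: lt_le_trans mu1.
(* The number of moves performed will be [s <= 2 * n / E]. The first inequality keeps [tau * n / 2]
   moves available although each one performed may destroy [K1]; the second makes
   [lam * (2 * mu) ^+ G <= 1 / 2]. *)
have bnd : exists E : nat, [/\ (0 < E)%N, 4 * K1%:R <= tau * E%:R &
    (Kc * (1 + K2))%N%:R * 4 * (2 * mu) ^+ G * 2 <= tau * E%:R].
  pose c1 : R := (Kc * (1 + K2))%N%:R * 4 * (2 * mu) ^+ G * 2.
  have c10 : 0 <= c1 by rewrite /c1 !mulr_ge0 // exprn_ge0 // mulr_ge0 // ltW.
  have x0 : 0 <= (c1 + 4 * K1%:R) / tau.
    by apply: divr_ge0; [apply: addr_ge0 => //; exact: mulr_ge0 | exact: ltW].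
  exists (Num.bound ((c1 + 4 * K1%:R) / tau)).+1.
  have := archi_boundP x0; rewrite ltr_pdivrMr // mulrC => lt.
  have le : tau * (Num.bound ((c1 + 4 * K1%:R) / tau))%:R <=
      tau * (Num.bound ((c1 + 4 * K1%:R) / tau)).+1%:R.
    by rewrite ler_pM2l // ler_nat.
  have k0 : 0 <= K1%:R :> R by [].
  by split => //; rewrite -/c1; lra.
have [E [E0 EK1 Ec]] := bnd.
have ER : 0 < E%:R :> R by rewrite ltr0n.
have [q /andP[q0 q1] qE] := @near_one_root R (2^-1) E ltac:(lra).
have q2 : 2^-1 <= q.
  apply: le_trans qE _; case: (E) E0 => // e _; rewrite exprS.
  by apply: ler_piMr; [exact: ltW | apply: exprn_ile1; exact: ltW].
(* Strictly between [mu] and [mu / q], so that [theta * q < mu]; [q >= 1 / 2] keeps it below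
   [2 * mu]. *)
pose theta : R := mu * (1 + q) / (2 * q).
have q20 : 0 < 2 * q by lra.
have mut : mu < theta.
  rewrite /theta ltr_pdivlMr // ltr_pM2l //; lra.
have theta2 : theta <= 2 * mu.
  rewrite /theta ler_pdivrMr // [2 * mu]mulrC -mulrA ler_pM2l //; lra.
have th0 : 0 < theta by apply: lt_trans mut.
have [C C0 leC] := size_rooted_le mu1 up mut.
have tq : theta * q < mu.
  have -> : theta * q = mu * ((1 + q) / 2) by rewrite /theta; field; rewrite gt_eqF.
  rewrite gtr_pMr //; lra.
exists E%:R^-1, C, (theta * q), E.
split => //; first by rewrite invr_gt0.
  by apply/andP; split => //; exact: mulr_gt0.
move=> M K moves codes step mark umv szc mvP pres inj n En.
have n0 : (0 < n)%N by apply: leq_trans En.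
have nR : 0 < n%:R :> R by rewrite ltr0n.
(* As many moves as there may be marks at the start: the number of marks, hence of codes, stays of
   order [s]. *)
pose s := (n %/ E).+1.
have sE : (s * E <= 2 * n)%N.
  by rewrite /s mulSn mul2n -addnn leq_add // leq_divM.
have nsE : (n <= E * s)%N by rewrite mulnC ltnW // ltn_ceil.
have sER : s%:R * E%:R <= 2 * n%:R :> R by rewrite -!natrM ler_nat.
pose lam : R := (Kc * (1 + K2) * s)%N%:R / (tau * n%:R / 2).
have tn2 : 0 < tau * n%:R / 2 by rewrite divr_gt0 // mulr_gt0.
have lam0 : 0 <= lam by rewrite divr_ge0 // ltW.
have lamG : lam * (2 * mu) ^+ G <= 2^-1.
  have P0 : 0 <= (2 * mu) ^+ G by rewrite exprn_ge0 // mulr_ge0 // ltW.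
  rewrite /lam mulrAC ler_pdivrMr // natrM.
  rewrite -(ler_pM2r ER).
  set a : R := (_ * _)%N%:R in Ec *; set b := _ ^+ G in Ec P0 *.
  have h1 : a * b * (s%:R * E%:R) <= a * b * (2 * n%:R).
    by rewrite ler_wpM2l // mulr_ge0.
  have h2 : a * 4 * b * 2 * n%:R <= tau * E%:R * n%:R by rewrite ler_wpM2r.
  nra.
pose Inv t w := [/\ rooted_saw w, (size w <= (n + G * t).+1)%N,
  tau * n%:R <= (size (moves w) + K1 * t)%N%:R & (mark w <= s + K2 * t)%N].
pose A := [seq w <- saws dirs n | ((mark w)%:R < E%:R^-1 * n%:R :> R) &&
  (tau * n%:R <= (size (moves w))%:R)].
have uA : uniq A by rewrite filter_uniq // uniq_saws.
have AInv w : w \in A -> Inv 0 w.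
  rewrite mem_filter saws_rooted => /andP[/andP[mk mv] /andP[/eqP sw rw]].
  split; rewrite // ?muln0 ?addn0 ?sw //.
  move: mk; rewrite mulrC ltr_pdivlMr // -natrM ltr_nat => mk.
  by rewrite ltnW // ltnS leq_divRL // ltnW.
have movesn t w : (t < s)%N -> Inv t w -> tau * n%:R / 2 <= (size (moves w))%:R.
  move=> ts [_ _ mv _]; move: mv; rewrite natrD natrM.
  have : K1%:R * t%:R <= K1%:R * s%:R :> R by rewrite ler_wpM2l // ler_nat ltnW.
  have : K1%:R * s%:R * E%:R <= tau * n%:R / 2 * E%:R.
    have : 4 * K1%:R * (s%:R * E%:R) <= 4 * K1%:R * (2 * n%:R) :> R.
      by rewrite ler_wpM2l // mulr_ge0.
    have : 4 * K1%:R * n%:R <= tau * E%:R * n%:R by rewrite ler_wpM2r.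
    lra.
  by rewrite ler_pM2r //; lra.
have Inv_step t w m w' k : (t < s)%N -> Inv t w -> m \in moves w ->
    step w m w' k -> Inv t.+1 w'.
  move=> ts [rw sw mvw mk] mw st.
  have [rw' sw' mv' mk'] := pres _ _ _ _ rw mw st.
  split; first exact: rw'.
  - by clear - sw sw'; lia.
  - by apply: le_trans mvw _; rewrite ler_nat; clear - mv'; lia.
  - by clear - mk mk'; lia.
have [||B [uB AB BInv]] := @double_count_iter R _ _ _ moves codes step Inv lam s
  (fun t w ts Iw => umv w (let: And4 rw _ _ _ := Iw in rw))
  _ _ Inv_step inj lam0 A uA AInv s (leqnn s).
- move=> t w ts Iw; have := movesn _ _ ts Iw.
  by case: (moves w) => //=; rewrite leNgt tn2.
- move=> t w m ts Iw mw; have [rw _ _ _] := Iw.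
  have [w' [k [st kc]]] := mvP _ _ rw mw.
  exists w', k; split => //.
  have [_ _ _ mk'] := Inv_step _ _ _ _ _ ts Iw mw st.
  have mvw := movesn _ _ ts Iw.
  have le : (size (codes w') <= Kc * (1 + K2) * s)%N.
    by apply: leq_trans (szc w') _; rewrite -mulnA leq_mul2l; apply/orP; right; clear - ts mk'; nia.
  apply: le_trans (_ : (Kc * (1 + K2) * s)%N%:R <= _); first by rewrite ler_nat.
  by rewrite /lam mulrAC ler_pdivlMr // ler_wpM2l.
rewrite -size_filter -/A; clearbody lam theta.
apply: le_trans AB _.
have leB : (size B)%:R <= C * theta ^+ (n + G * s).
  by apply: leC => // w /BInv[].
apply: le_trans (ler_wpM2l (exprn_ge0 _ lam0) leB) _.
rewrite mulrCA ler_pM2l // exprMn exprD mulrCA ler_pM2l ?exprn_gt0 //.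
(* The gain per move pays for the growth of the length by [G] and leaves
   [2 ^- s <= q ^+ (E * s) <= q ^+ n]. *)
rewrite exprM -exprMn; apply: le_trans (_ : (q ^+ E) ^+ s <= _); last first.
  by rewrite -exprM ler_wiXn2l ?(ltW q0) ?(ltW q1).
apply: lerXn2r; rewrite ?nnegrE ?exprn_ge0 ?(ltW q0) ?mulr_ge0 ?exprn_ge0 ?(ltW th0) //.
apply: le_trans qE; apply: le_trans lamG; rewrite ler_wpM2l //.
by apply: lerXn2r; rewrite ?nnegrE ?(ltW th0) ?mulr_ge0 ?(ltW mu0).
Qed.
End Switching.

(** * U-turns and ladders *)

Section Uturns.
Variables (V : zmodType) (dirs : seq V).
Implicit Types (x y : V) (Z w : seq V).
Local Notation adj := (adj dirs).

(* On the lattice this says that the steps [p] and [p + 2] are opposite. The two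
   inner vertices of a U-turn can always be cut off, leaving a walk. *)
Definition uturn Z p := (p.+3 < size Z)%N && adj (nth (0 : V) Z p) (nth (0 : V) Z p.+3).
Definition uturns Z := [seq p <- iota 0 (size Z) | uturn Z p].
Definition nU Z := size (uturns Z).

Lemma mem_uturns Z p : (p \in uturns Z) = uturn Z p.
Proof.
rewrite mem_filter mem_iota add0n; case uE: (uturn Z p) => //=.
by case/andP: uE; lia.
Qed.

Lemma uniq_uturns Z : uniq (uturns Z).
Proof. exact/filter_uniq/iota_uniq. Qed.

Lemma nU_size Z : (nU Z <= size Z)%N.
Proof. by rewrite -[leqRHS](size_iota 0) /nU size_filter count_size. Qed.

Lemma uturn_catl A B p : uturn A p -> uturn (A ++ B) p.
Proof.
move=> /andP[sp ap]; rewrite /uturn size_cat !nth_cat sp.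
have -> : (p < size A)%N by lia.
by rewrite ap andbT; lia.
Qed.

Lemma uturn_catr A B p : uturn (A ++ B) (size A + p) = uturn B p.
Proof.
rewrite /uturn size_cat -!addnS !nth_cat !ltnNge !leq_addr /= !addKn.
by rewrite leqNgt ltn_add2l -leqNgt.
Qed.

Lemma nU_cat_ge A B : (nU A + nU B <= nU (A ++ B))%N.
Proof.
rewrite /nU -[size (uturns B)](size_map (addn (size A))) -size_cat.
apply: uniq_leq_size.
  rewrite cat_uniq uniq_uturns map_inj_uniq; last exact: addnI.
  rewrite uniq_uturns andbT; apply/hasPn => _ /mapP[p _ ->].
  by rewrite mem_uturns /uturn; lia.
move=> p; rewrite mem_cat => /orP[|/mapP[q + ->]]; rewrite !mem_uturns.
  exact: uturn_catl.
by rewrite uturn_catr.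
Qed.

(** A U-turn spans four vertices, so one that straddles the junction starts at one of the last three
    vertices of [A]. *)
Lemma nU_cat_le A B : (nU (A ++ B) <= nU A + nU B + 3)%N.
Proof.
rewrite /nU -[size (uturns B)](size_map (addn (size A))) -size_cat.
rewrite -[3%N]/(size [:: (size A - 1)%N; (size A - 2)%N; (size A - 3)%N]) -size_cat.
apply: uniq_leq_size (uniq_uturns _) _ => p.
rewrite !mem_cat !mem_uturns => up.
case: (ltnP p (size A)) => pA; last first.
  apply/orP; left; apply/orP; right; apply/mapP; exists (p - size A)%N.
    by rewrite mem_uturns -(uturn_catr A) subnKC.
  by rewrite subnKC.
case: (ltnP p.+3 (size A)) => pA3.
  move: up; rewrite /uturn !nth_cat pA pA3 => /andP[_ ->].
  by [].
by rewrite !inE; apply/orP; right; lia.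
Qed.

Lemma nU_shift z Z : nU [seq x + z | x <- Z] = nU Z.
Proof.
congr size; rewrite /uturns size_map; apply: eq_filter => p.
rewrite /uturn size_map; case: ltnP => //= pZ.
rewrite (nth_map (0 : V)) ?(nth_map (0 : V) _ _ pZ) ?adjD //.
by apply: leq_trans pZ; rewrite !ltnS; lia.
Qed.

Lemma nU_rev_le Z : symmetric adj -> (nU Z <= nU (rev Z))%N.
Proof.
move=> sym; rewrite /nU -(size_map (fun p => size Z - p.+4)%N).
apply: uniq_leq_size.
  rewrite map_inj_in_uniq ?uniq_uturns // => p q.
  by rewrite !mem_uturns => /andP[+ _] /andP[+ _]; lia.
move=> _ /mapP[p + ->]; rewrite !mem_uturns => /andP[sp ap].
rewrite /uturn size_rev !nth_rev; try lia; apply/andP; split; first lia.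
rewrite sym.
have -> : (size Z - (size Z - p.+4).+1 = p.+3)%N by lia.
by have -> : (size Z - (size Z - p.+4).+4 = p)%N by lia.
Qed.

Lemma nU_rev Z : symmetric adj -> nU (rev Z) = nU Z.
Proof.
move=> sym; apply/eqP; rewrite eqn_leq nU_rev_le // andbT.
by rewrite -{2}(revK Z) nU_rev_le.
Qed.

Lemma uturnP Z p : reflect
  (exists A x u v y B, [/\ Z = A ++ [:: x, u, v, y & B], size A = p & adj x y])
  (uturn Z p).
Proof.
apply: (iffP andP) => [[sp ap]|[A [x [u [v [y [B [-> <- axy]]]]]]]]; last first.
  rewrite size_cat /= !nth_cat ltnn subnn !ltnNge; split; first lia.
  have -> : (size A <= (size A).+3)%N by lia.
  by have -> : ((size A).+3 - size A = 3)%N by lia.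
exists (take p Z), (nth (0 : V) Z p), (nth (0 : V) Z p.+1), (nth (0 : V) Z p.+2), (nth (0 : V) Z p.+3),
  (drop p.+4 Z); split => //; last by rewrite size_take; case: ltnP; lia.
by rewrite -!drop_nth ?cat_take_drop //; lia.
Qed.

End Uturns.

Section Ladders.
Variables (V : zmodType) (dirs : seq V).
Hypothesis dirsN : forall a, a \in dirs -> - a \in dirs.
Implicit Types (x y : V) (Q Z w : seq V).
Local Notation adj := (adj dirs).

(* A 3 x 2 grid of vertices. It is enough for the rerouting below because any two
   of its vertices are joined inside it by a path making a U-turn. *)
Definition rungs (a b : V) := [:: 0; a; a + a; b; a + b; a + a + b].
Definition ladder z a b := [seq z + o | o <- rungs a b].
(** Distinctness of the six vertices stands for perpendicularity, which has no meaning in a general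
    group; for unit vectors of the lattice it excludes exactly [b = a] and [b = - a]. *)
Definition ladder_dirs :=
  [seq ab <- [seq (a, b) | a <- dirs, b <- dirs] | uniq (rungs ab.1 ab.2)].
Definition ladders v :=
  [seq ladder (v - nth (0 : V) (rungs c.1.1 c.1.2) c.2) c.1.1 c.1.2 |
    c <- [seq (ab, t) | ab <- ladder_dirs, t <- iota 0 6]].

Lemma size_ladders v : (size (ladders v) <= size dirs ^ 2 * 6)%N.
Proof.
rewrite size_map size_allpairs size_iota leq_mul2r /= size_filter.
by apply: leq_trans (count_size _ _) _; rewrite size_allpairs.
Qed.

Lemma mem_ladders v Q : reflect
  (exists z a b, [/\ (a, b) \in ladder_dirs, Q = ladder z a b & v \in Q])
  (Q \in ladders v).
Proof.
apply: (iffP mapP) => [[c /allpairsPdep[[a b] [t [abP tP ->]]] ->]|].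
  exists (v - nth (0 : V) (rungs a b) t), a, b; split => //=.
  apply/mapP; exists (nth (0 : V) (rungs a b) t); last by rewrite subrK.
  by apply: mem_nth; rewrite mem_iota in tP.
move=> [z [a [b [abP -> /mapP[o /(nthP (0 : V))[t tP <-] vE]]]]].
exists ((a, b), t); last by rewrite vE addrK.
by apply/allpairsPdep; exists (a, b), t; split => //; rewrite mem_iota.
Qed.

Lemma uniq_ladder v Q : Q \in ladders v -> uniq Q.
Proof.
move=> /mem_ladders[z [a [b [+ -> _]]]]; rewrite mem_filter => /andP[uab _].
by rewrite map_inj_uniq //; exact: addrI.
Qed.

Lemma size_ladder v Q : Q \in ladders v -> size Q = 6%N.
Proof. by move=> /mem_ladders[z [a [b [_ -> _]]]]. Qed.

Lemma ladders_sub u v Q : Q \in ladders v -> u \in Q -> Q \in ladders u.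
Proof.
move=> /mem_ladders[z [a [b [abP -> _]]]] uQ; apply/mem_ladders.
by exists z, a, b.
Qed.

(* The edges of the ladder with vertices 0 - 1 - 2 below 3 - 4 - 5. *)
Definition rung_adj (i j : nat) :=
  (minn i j, maxn i j) \in
    [:: (0, 1); (1, 2); (3, 4); (4, 5); (0, 3); (1, 4); (2, 5)]%N.

(** One path for each of the 15 pairs of vertices, reversal giving the other direction. A single
    square would not do: its opposite corners are joined only by two-step paths, too short for a
    U-turn. *)
Definition rung_paths : seq (seq nat) :=
  let s := [:: [:: 0; 3; 4; 1]; [:: 1; 4; 5; 2]; [:: 3; 0; 1; 4];
    [:: 4; 1; 2; 5]; [:: 0; 1; 4; 3]; [:: 2; 1; 4; 5]; [:: 1; 0; 3; 4];
    [:: 0; 3; 4; 1; 2]; [:: 3; 0; 1; 4; 5]; [:: 0; 1; 2; 5; 4];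
    [:: 1; 2; 5; 4; 3]; [:: 1; 0; 3; 4; 5]; [:: 2; 1; 0; 3; 4];
    [:: 0; 3; 4; 1; 2; 5]; [:: 2; 5; 4; 1; 0; 3]]%N in
  s ++ map rev s.

Definition rung_path_ok (i j : nat) (s : seq nat) :=
  [&& head 0%N s == i, last 0 s == j, uniq s, sorted rung_adj s,
    all (fun k => k < 6)%N s &
    has (fun p => (p.+3 < size s) && rung_adj (nth 0%N s p) (nth 0%N s p.+3)) (iota 0 6)]%N.

Lemma rung_path_exists i j : (i < 6)%N -> (j < 6)%N -> i != j ->
  exists s, rung_path_ok i j s.
Proof.
have: all (fun i => all (fun j => (i != j) ==> has (rung_path_ok i j) rung_paths)
  (iota 0 6)) (iota 0 6) by vm_compute.
move=> /allP H i6 j6 ij; have := H i; rewrite mem_iota => /(_ i6) /allP /(_ j).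
rewrite mem_iota ij => /(_ j6) /hasP[s _ ok]; by exists s.
Qed.

Lemma ladder_adj v Q i j : Q \in ladders v -> rung_adj i j ->
  adj (nth (0 : V) Q i) (nth (0 : V) Q j).
Proof.
move=> /mem_ladders[z [a [b [+ -> _]]]]; rewrite mem_filter => /andP[_].
move=> /allpairsPdep[a' [b' [aP bP [ea eb]]]]; subst a' b'.
wlog ij : i j / (i <= j)%N => [H|].
  case: (leqP i j) => ij; first exact: H.
  rewrite adj_sym // /rung_adj minnC maxnC; apply: H; exact: ltnW.
rewrite /rung_adj (minn_idPl ij) (maxn_idPr ij) !inE.
have step := @adj_step _ dirs.
rewrite !xpair_eqE; do !case/orP; move=> /andP[/eqP -> /eqP ->] /=; rewrite ?addr0.
- exact: step.
- by rewrite addrA; exact: step.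
- by rewrite [a + b]addrC addrA; exact: step.
- by rewrite -addrA [a + b]addrC !addrA -[z + a + b]addrA [a + b]addrC addrA; exact: step.
- exact: step.
- by rewrite addrA; exact: step.
- by rewrite [z + (a + a + b)]addrA; exact: step.
Qed.

Lemma ladder_path v Q x y : Q \in ladders v -> x \in Q -> y \in Q -> x != y ->
  exists p, [/\ uniq (x :: p), last x p = y, path adj x p,
    {subset x :: p <= Q} & exists q, q \in uturns dirs (x :: p)].
Proof.
move=> Qv /(nthP (0 : V))[i iQ <-] /(nthP (0 : V))[j jQ <-] xy.
have sQ := size_ladder Qv; rewrite sQ in iQ jQ.
have ij : i != j by apply: contraNneq xy => ->.
have [s] := rung_path_exists iQ jQ ij.
case: s => [|k s]; first by rewrite /rung_path_ok /= !andbF.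
case/and5P; rewrite [head _ _]/= [last _ _]/= => /eqP <- /eqP jE us ss /andP[s6 /hasP[q _ /andP[qs qa]]].
have nthE r : (r < size (k :: s))%N -> nth (0 : V) [seq nth (0 : V) Q l | l <- k :: s] r =
    nth (0 : V) Q (nth 0%N (k :: s) r).
  by move=> rs; rewrite (nth_map 0%N).
exists [seq nth (0 : V) Q l | l <- s]; split.
- rewrite -map_cons map_inj_in_uniq //.
  move=> l l' /(allP s6) l6 /(allP s6) l'6 /eqP.
  by rewrite nth_uniq ?sQ ?(uniq_ladder Qv) // => /eqP.
- by rewrite last_map -jE.
- have : sorted rung_adj (k :: s) by [].
  rewrite /= -[path adj _ _]/(sorted adj (map (nth (0 : V) Q) (k :: s))) sorted_map.
  apply: sub_path => l l'; exact: ladder_adj Qv.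
- move=> u; rewrite -map_cons => /mapP[l /(allP s6) l6 ->].
  by rewrite mem_nth // sQ.
- exists q; rewrite mem_uturns /uturn -map_cons size_map qs.
  by rewrite !nthE //; [exact: ladder_adj Qv qa | lia].
Qed.

End Ladders.

(** * Rerouting inside a ladder *)

Lemma cat_eq_split (T : Type) (s1 s2 t1 t2 : seq T) :
  s1 ++ s2 = t1 ++ t2 -> (size t1 <= size s1)%N ->
  exists r, s1 = t1 ++ r /\ t2 = r ++ s2.
Proof.
elim: t1 s1 => [|x t1 IH] [|y s1] //=; first by exists [::].
  by move=> e _; exists (y :: s1).
by move=> [-> e] le; have [r [-> ->]] := IH _ e le; exists r.
Qed.

Lemma index_catl (T : eqType) (s1 s2 : seq T) u : u \in s1 ->
  (index u (s1 ++ s2) < size s1)%N.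
Proof. by move=> us; rewrite index_cat us index_mem. Qed.

Lemma index_catr (T : eqType) (s1 s2 : seq T) u : u \notin s1 ->
  (size s1 <= index u (s1 ++ s2))%N.
Proof. by move=> /negbTE us; rewrite index_cat us leq_addr. Qed.

Section Surgery.
Variables (V : zmodType) (dirs : seq V).
Hypothesis dirsN : forall a, a \in dirs -> - a \in dirs.
Hypothesis ud : uniq dirs.
Implicit Types (x y v : V) (Q w A B C p : seq V) (m : nat).
Local Notation adj := (adj dirs).

Definition avoids Q w := ~~ has (mem Q) w.

(* [x] and [y] are the first and the last visit of [w] to the ladder [Q] through [v]. *)
Definition window m w v Q A x B y C : Prop :=
  [/\ w = A ++ (x :: rcons B y) ++ C, v \in x :: rcons B y, (size B <= m)%N &
  [/\ Q \in ladders dirs v, x \in Q, y \in Q, avoids Q A & avoids Q C]].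

Definition available m w v : Prop :=
  exists Q A x B y C, window m w v Q A x B y C.

(** Moves are indexed by vertices and not by ladders: there are no repetitions, and disjoint blocks
    of the walk contribute additively. *)
Definition avails m w := [seq v <- w | `[< available m w v >]].

(* The part of [w] between its first and last visit to [Q] is replaced by a path
   inside [Q] making a U-turn. The code [k] records the position of that U-turn
   in [w'], and what was cut out, up to translation. *)
Definition reroute m w v w' (k : nat * (nat * (nat * (seq V * nat)))) : Prop :=
  exists Q A x B y C p q, [/\ window m w v Q A x B y C,
    [/\ uniq (x :: p), last x p = y, path adj x p & {subset x :: p <= Q}],
    q \in uturns dirs (x :: p), w' = A ++ (x :: p) ++ C &
    k = (size A + q, (q, (size (x :: p),
          (shift (x :: rcons B y), index v (x :: rcons B y)))))%N].

(** The new path has at most six vertices, the replaced segment [x, B, y] at most [m + 2], that is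
    [m + 1] steps. The list depends on [m] only, so the codes of a walk are proportional in number
    to its U-turns. *)
Definition reroute_data m :=
  [seq (q, e) | q <- iota 0 6, e <-
  [seq (l, f) | l <- iota 0 7, f <-
  [seq (sg, iv) | sg <- flatten [seq paths dirs 0 j | j <- iota 0 m.+2],
                  iv <- iota 0 m.+2]]].

Definition reroute_codes m w :=
  [seq (r, c) | r <- uturns dirs w, c <- reroute_data m].

Lemma size_reroute_codes m w :
  size (reroute_codes m w) = (size (reroute_data m) * nU dirs w)%N.
Proof. by rewrite size_allpairs mulnC. Qed.

Lemma avails_uniq m w : saw dirs w -> uniq (avails m w).
Proof. by case/andP=> uw _; exact: filter_uniq. Qed.

Lemma mem_avails m w v : v \in avails m w -> v \in w /\ available m w v.
Proof. by rewrite mem_filter => /andP[/asboolP]. Qed.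

Lemma reroute_code m w v w' k : saw dirs w -> reroute m w v w' k ->
  k \in reroute_codes m w'.
Proof.
move=> /andP[_ srt] [Q [A [x [B [y [C [p [q]]]]]]]].
case=> -[wE vB sB [Qv xQ yQ _ _]] [up lp pp pQ] qp w'E ->.
have sp : (size (x :: p) <= 6)%N.
  by rewrite -(size_ladder Qv); exact: uniq_leq_size.
have qs : (q.+3 < size (x :: p))%N by move: qp; rewrite mem_uturns => /andP[].
apply: allpairs_f.
  by rewrite mem_uturns w'E uturn_catr; apply: uturn_catl; rewrite -mem_uturns.
apply: allpairs_f.
  by rewrite mem_iota add0n; apply: leq_trans sp; apply: leq_trans qs; rewrite ltnS ltnW // ltnW.
apply: allpairs_f; first by rewrite mem_iota add0n ltnS.
apply: allpairs_f; last first.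
  rewrite mem_iota leq0n add0n; apply: leq_trans (_ : size (x :: rcons B y) <= _)%N.
    by rewrite index_mem.
  by rewrite /= size_rcons !ltnS.
apply/flattenP; exists (paths dirs 0 (size B).+1).
  by apply/mapP; exists (size B).+1; rewrite // mem_iota /= add0n !ltnS.
rewrite mem_paths size_shift head_shift sorted_translate /= size_rcons !eqxx /=.
by move: srt; rewrite wE => /cat_sorted2[_ /cat_sorted2[]].
Qed.

(** The code gives the size of [A] as a difference and the length of the new path, hence [A], the
    path and [C]; its first vertex [x] translates the stored segment back, and the index recovers
    the vertex. *)
Lemma reroute_inj m w1 v1 w2 v2 w' k :
  reroute m w1 v1 w' k -> reroute m w2 v2 w' k -> w1 = w2 /\ v1 = v2.
Proof.
move=> [Q [A [x [B [y [C [p [q]]]]]]]] [[wE vB _ _] _ _ w'E kE].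
move=> [Q2 [A2 [x2 [B2 [y2 [C2 [p2 [q2]]]]]]]] [[wE2 vB2 _ _] _ _ w'E2].
rewrite kE => kE2.
have eA : (size A + q = size A2 + q2)%N := congr1 fst kE2.
have eq : q = q2 := congr1 (fun t => t.2.1) kE2.
have ep : size (x :: p) = size (x2 :: p2) := congr1 (fun t => t.2.2.1) kE2.
have eB : shift (x :: rcons B y) = shift (x2 :: rcons B2 y2) :=
  congr1 (fun t => t.2.2.2.1) kE2.
have ev : index v1 (x :: rcons B y) = index v2 (x2 :: rcons B2 y2) :=
  congr1 (fun t => t.2.2.2.2) kE2.
have sA : size A = size A2 by lia.
have := w'E; rewrite w'E2 => /eqP; rewrite eqseq_cat // => /andP[/eqP AE].
rewrite eqseq_cat // => /andP[/eqP xpE /eqP CE].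
have xE : x2 = x := congr1 (head (0 : V)) xpE.
have BE : x :: rcons B y = x2 :: rcons B2 y2.
  move: eB; rewrite /shift /= xE => -[].
  by move=> /(inj_map (@addIr V (- x))) ->.
rewrite wE wE2 BE AE CE; split => //.
by rewrite -(nth_index (0 : V) vB) -(nth_index (0 : V) vB2) ev BE.
Qed.

Lemma reroute_exists m w v : saw dirs w -> available m w v ->
  exists w' k, reroute m w v w' k.
Proof.
move=> /andP[uw _] [Q [A [x [B [y [C win]]]]]].
case: (win) => wE vB sB [Qv xQ yQ AQ CQ].
have xy : x != y.
  move: uw; rewrite wE !cat_uniq => /and3P[_ _ /andP[/andP[]]].
  by rewrite mem_rcons inE negb_or => /andP[].
have [p [up lp pp pQ [q qU]]] := ladder_path dirsN Qv xQ yQ xy.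
by do 2!eexists; exists Q, A, x, B, y, C, p, q; split; try reflexivity.
Qed.

Lemma sorted_splice A C x y B p : last x p = y -> path adj x p ->
  sorted adj (A ++ (x :: rcons B y) ++ C) -> sorted adj (A ++ (x :: p) ++ C).
Proof.
move=> lp pp srt.
have : path adj y C.
  by move: srt => /cat_sorted2[_] /=; rewrite cat_path last_rcons => /andP[].
rewrite -lp => pC.
have xpC : path adj x (p ++ C) by rewrite cat_path pp.
case: A srt => [|a A] //=; rewrite !cat_path /= => /and3P[-> -> _].
by rewrite cat_path pp.
Qed.

(** The new path stays in [Q], which the rest of the walk avoids. *)
Lemma reroute_saw m w v w' k : rooted_saw dirs w -> reroute m w v w' k ->
  rooted_saw dirs w' /\ (size w' <= size w + 6)%N.
Proof.
move=> /and3P[_ hw /andP[uw sw]] [Q [A [x [B [y [C [p [q]]]]]]]].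
move=> [[wE vB sB [Qv xQ yQ AQ CQ]] [up lp pp pQ] qp w'E _].
have sp : (size (x :: p) <= 6)%N.
  by rewrite -(size_ladder Qv); exact: uniq_leq_size.
split; last first.
  rewrite w'E wE !size_cat; move: sp.
  by move: (size (x :: p)) (size A) (size C) (size (x :: rcons B y)); clear => *; lia.
apply/and3P; split; first by rewrite w'E; case: (A).
  by move: hw; rewrite w'E wE; case: (A).
apply/andP; split; last by rewrite w'E; apply: (sorted_splice (B := B) lp pp); rewrite -wE.
have disj Z : avoids Q Z -> ~~ has [in Z] (x :: p).
  move=> /hasPn QZ; apply/hasPn => u /pQ uQ; apply/negP => uZ.
  by have := QZ u uZ; rewrite /= uQ.
have splice P S : uniq P -> ~~ has [in A] P -> ~~ has [in P] C ->
    uniq (A ++ S ++ C) -> uniq (A ++ P ++ C).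
  rewrite !cat_uniq !has_cat !negb_or => -> -> ->.
  by case/and3P=> -> /andP[_ ->] /and3P[_ _ ->].
rewrite w'E; apply: (splice _ (x :: rcons B y)) => //; last by rewrite -wE.
  exact: disj.
apply/hasPn => u uC; apply/negP => /pQ uQ.
by move/hasPn: CQ => /(_ u uC); rewrite /= uQ.
Qed.

(** At most 6 U-turns start in the new path and at most 3 arise at each of its two ends. *)
Lemma reroute_nU m w v w' k : reroute m w v w' k -> (nU dirs w' <= nU dirs w + 12)%N.
Proof.
move=> [Q [A [x [B [y [C [p [q]]]]]]]].
move=> [[wE vB sB [Qv xQ yQ AQ CQ]] [up lp pp pQ] qp w'E _].
have sp : (size (x :: p) <= 6)%N.
  by rewrite -(size_ladder Qv); exact: uniq_leq_size.
have := nU_cat_le dirs A ((x :: p) ++ C); have := nU_cat_le dirs (x :: p) C.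
have := nU_size dirs (x :: p).
have := nU_cat_ge dirs A ((x :: rcons B y) ++ C).
have := nU_cat_ge dirs (x :: rcons B y) C.
rewrite -w'E -wE; move: sp; move: (size _) (nU dirs w) (nU dirs w').
move: (nU dirs (_ ++ C)) (nU dirs A) (nU dirs (_ ++ C)) (nU dirs C).
by move: (nU dirs _) (nU dirs _); clear => *; lia.
Qed.

(** The first term counts vertices close to the replaced segment. The second counts vertices of
    ladders meeting the new path: 6 vertices, each in at most [size dirs ^ 2 * 6] ladders of 6
    vertices. *)
Definition reroute_loss m := (3 * m.+2 + 6 * (size dirs ^ 2 * 6 * 6))%N.

Lemma reroute_avails m w v w' k : saw dirs w -> reroute m w v w' k ->
  (size (avails m w) <= size (avails m w') + reroute_loss m)%N.
Proof.
move=> sw [Q [A [x [B [y [C [p [q]]]]]]]].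
move=> [[wE vB sB [Qv xQ yQ AQ CQ]] [up lp pp pQ] qp w'E _].
set seg := x :: rcons B y in wE vB.
have sp : (size (x :: p) <= 6)%N.
  by rewrite -(size_ladder Qv); exact: uniq_leq_size.
pose dmg := flatten [seq flatten (ladders dirs u) | u <- x :: p].
(* A window has at most [m + 2] vertices, so around a vertex outside [near] it lies wholly in [A] or
   in [C]. If its ladder also misses the new path, it is still a window of [w']. *)
pose near := drop (size A - m.+2) A ++ seg ++ take m.+2 C.
have s_near : (size near <= 3 * m.+2)%N.
  rewrite !size_cat size_drop /= size_rcons size_take.
  have : ((if m.+2 < size C then m.+2 else size C) <= m.+2)%N by case: ltnP.
  by move: sB (size A) (if _ then _ else _); move: (size B); clear => *; lia.
have s_dmg : (size dmg <= 6 * (size dirs ^ 2 * 6 * 6))%N.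
  apply: leq_trans (_ : (size (x :: p) * (size dirs ^ 2 * 6 * 6) <= _))%N; last first.
    by rewrite leq_mul2r sp orbT.
  rewrite /dmg; elim: (x :: p) => //= u s IH.
  rewrite size_cat mulSn leq_add //.
  apply: leq_trans (_ : (size (ladders dirs u) * 6 <= _))%N; last first.
    by rewrite leq_mul2r size_ladders orbT.
  have : {subset ladders dirs u <= ladders dirs u} by [].
  elim: {1 3 4}(ladders dirs u) => //= Q' l IHl sub.
  rewrite size_cat mulSn leq_add //.
    by rewrite (size_ladder (sub Q' _)) // inE eqxx.
  by apply: IHl => Q'' Q''l; apply: sub; rewrite inE Q''l orbT.
apply: leq_trans (_ : size (avails m w' ++ (near ++ dmg)) <= _)%N; last first.
  by rewrite size_cat leq_add2l size_cat; exact: leq_add.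
apply: uniq_leq_size; first exact: avails_uniq.
move=> u /mem_avails[uw [Q' [A' [x' [B' [y' [C' [wE' uB' sB' [Q'u x'Q y'Q A'Q C'Q]]]]]]]]].
rewrite mem_cat [u \in near ++ dmg]mem_cat.
case udmg: (u \in dmg); first by rewrite !orbT.
rewrite orbF; case unear: (u \in near); first by rewrite orbT.
rewrite orbF.
have pQ' : avoids Q' (x :: p).
  apply/hasPn => t tp; apply/negP => /= tQ'.
  move/negP: udmg; apply; apply/flattenP; exists (flatten (ladders dirs t)).
    exact: (map_f (fun z => flatten (ladders dirs z)) tp).
  apply/flattenP; exists Q'; first exact: ladders_sub Q'u tQ'.
  by move/mem_ladders: Q'u => [? [? [? []]]].
suff av : available m w' u.
  suff uw' : u \in w' by rewrite mem_filter uw' (asboolT av).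
  case: av => Q3 [A3 [x3 [B3 [y3 [C3 [-> u3 _ _]]]]]].
  by rewrite !mem_cat u3 orbT.
have av_cat Z Y : avoids Q' (Z ++ Y) = avoids Q' Z && avoids Q' Y.
  by rewrite /avoids has_cat negb_or.
set seg' := x' :: rcons B' y' in wE' uB'.
have s_seg' : (size seg' <= m.+2)%N by rewrite /= size_rcons !ltnS.
have eqw : A ++ seg ++ C = A' ++ seg' ++ C' by rewrite -wE.
have uA' : u \notin A'.
  case/andP: sw; rewrite wE' cat_uniq => /and3P[_ + _] _.
  by apply: contra => uA'; apply/hasP; exists u; rewrite // mem_cat uB'.
have iu1 : (size A' <= index u w)%N by rewrite wE' index_catr.
have iu2 : (index u w < size A' + size seg')%N.
  by rewrite -size_cat wE' catA index_catl // mem_cat uB' orbT.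
have : u \in take (size A - m.+2) A ++ drop m.+2 C.
  move: uw unear; rewrite /near wE -{1}(cat_take_drop (size A - m.+2) A).
  rewrite -{1}(cat_take_drop m.+2 C) !mem_cat.
  by do !case: (u \in _).
rewrite mem_cat => /orP[uA|uC].
  have iu3 : (index u w < size A - m.+2)%N.
    apply: leq_trans (_ : size (take (size A - m.+2) A) <= _)%N; last first.
      by rewrite size_take; case: ltnP.
    by rewrite wE -{1}(cat_take_drop (size A - m.+2) A) -catA index_catl.
  have [|r [AE C'E]] := cat_eq_split (t1 := A' ++ seg') (etrans eqw (catA _ _ _)).
    move: iu1 iu3 s_seg'; rewrite size_cat.
    by move: (size A') (size A) (size seg') (index u w); clear => *; lia.
  move: C'Q; rewrite C'E !av_cat => /and3P[rQ _ CQ'].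
  exists Q', A', x', B', y', (r ++ (x :: p) ++ C); split => //.
    by rewrite w'E AE -!catA.
  by split; rewrite // !av_cat rQ pQ'.
have iu3 : (size A + size seg + m.+2 <= index u w)%N.
  have uA : u \notin A ++ seg ++ take m.+2 C.
    case/andP: sw; rewrite wE -{1}(cat_take_drop m.+2 C) !catA cat_uniq.
    move=> /and3P[_ + _] _; apply: contra => uA; apply/hasP; exists u => //.
  have szC : (m.+2 <= size C)%N.
    by rewrite leqNgt; apply/negP => lt; rewrite drop_oversize // ltnW in uC.
  have := index_catr (drop m.+2 C) uA; rewrite -!catA cat_take_drop -wE.
  by rewrite !size_cat size_takel // addnA.
have [|r [A'E CE]] := cat_eq_split (s1 := A') (t1 := A ++ seg)
    (etrans (esym eqw) (catA _ _ _)).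
  move: iu2 iu3 s_seg'; rewrite size_cat; move: (size A') (size A).
  by move: (size seg') (size seg) (index u w); clear => *; lia.
move: A'Q; rewrite A'E !av_cat => /andP[/andP[AQ' _] rQ].
exists Q', (A ++ (x :: p) ++ r), x', B', y', C'; split => //.
  by rewrite w'E CE -!catA.
by split; rewrite // !av_cat AQ' pQ'.
Qed.

(** An instance of [switching]: the moves are the available vertices, and the U-turn created by a
    rerouting is its mark. *)
Lemma nU_or_avails_rare (R : realType) (mu : R) : 1 <= mu ->
  (forall theta, mu < theta ->
    exists2 C, 0 < C & forall n, (cn dirs n)%:R <= C * theta ^+ n) ->
  forall (m : nat) (tau : R), 0 < tau ->
  exists (eps C rho : R) (n0 : nat), [/\ 0 < eps, 0 < C, 0 < rho < mu &
    forall n, (n0 <= n)%N ->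
    (count (fun w => ((nU dirs w)%:R < eps * n%:R) &&
       (tau * n%:R <= (size (avails m w))%:R)) (saws dirs n))%:R <= C * rho ^+ n].
Proof.
move=> mu1 up m tau tau0.
have [eps [C [rho [n0 [e0 C0 r0 H]]]]] := switching mu1 up ud
  (reroute_loss m) 12 (size (reroute_data m)) 6 tau0.
exists eps, C, rho, n0; split => // n nn0.
apply: (H _ _ (avails m) (reroute_codes m) (reroute m)) => //.
- by move=> w /and3P[_ _ sw]; exact: avails_uniq.
- by move=> w; rewrite size_reroute_codes.
- move=> w v /and3P[_ _ sw] /mem_avails[_ av].
  have [w' [k st]] := reroute_exists sw av.
  by exists w', k; split => //; exact: reroute_code st.
- move=> w v w' k rw _ st; have [rw' sw'] := reroute_saw rw st.
  split => //; last exact: reroute_nU st.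
  by apply: reroute_avails st; case/and3P: rw.
- by move=> *; apply: reroute_inj; eassumption.
Qed.

End Surgery.

(** * Cutting a walk into pieces *)

Section ExpSmall.
Variables (R : realType) (V : zmodType) (dirs : seq V) (mu : R).

(** Measured against [mu ^+ n], a lower bound for the number of walks; the proportion of such walks
    is thus exponentially small. *)
Definition exp_small (F : nat -> pred (seq V)) : Prop :=
  exists (C rho : R) (n0 : nat), [/\ 0 < C, 0 < rho < mu &
    forall n, (n0 <= n)%N -> (count (F n) (saws dirs n))%:R <= C * rho ^+ n].

Lemma exp_smallU (F G H : nat -> pred (seq V)) n1 :
  exp_small G -> exp_small H ->
  (forall n w, (n1 <= n)%N -> w \in saws dirs n -> F n w -> G n w || H n w) ->
  exp_small F.
Proof.
move=> [C1 [r1 [m1 [C10 /andP[r10 r1m] H1]]]] [C2 [r2 [m2 [C20 /andP[r20 r2m] H2]]]] FGH.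
exists (C1 + C2), (Num.max r1 r2), (maxn n1 (maxn m1 m2)).
split; first exact: addr_gt0.
  by rewrite lt_max r10 gt_max r1m r2m.
move=> n; rewrite !geq_max => /and3P[n1n m1n m2n].
apply: le_trans (_ : (count (G n) (saws dirs n) + count (H n) (saws dirs n))%N%:R <= _).
  rewrite ler_nat -count_predUI.
  apply: leq_trans (leq_addr _ _); rewrite -!size_filter.
  have -> : [seq w <- saws dirs n | F n w] =
      [seq w <- [seq w <- saws dirs n | predU (G n) (H n) w] | F n w].
    rewrite -filter_predI; apply: eq_in_filter => w ws /=.
    by case: (boolP (F n w)) => //= Fw; rewrite FGH.
  by rewrite size_filter count_size.
rewrite natrD mulrDl; apply: lerD.
  apply: le_trans (H1 _ m1n) _; rewrite ler_pM2l //.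
  by apply: lerXn2r; rewrite ?nnegrE ?le_max ?lexx ?(ltW r10) //.
apply: le_trans (H2 _ m2n) _; rewrite ler_pM2l //.
by apply: lerXn2r; rewrite ?nnegrE ?le_max ?lexx ?orbT ?(ltW r10) ?(ltW r20) //.
Qed.

Lemma exp_small_sub (F G : nat -> pred (seq V)) n1 : exp_small G ->
  (forall n w, (n1 <= n)%N -> w \in saws dirs n -> F n w -> G n w) -> exp_small F.
Proof.
move=> GS FG; apply: (exp_smallU (n1 := n1) GS GS) => n w nn ws Fw.
by rewrite (FG _ _ nn ws Fw).
Qed.

End ExpSmall.

Section Pieces.
Variables (V : zmodType).
Implicit Types (w : seq V).

(** Consecutive pieces share a vertex, so that each is a walk of [m] steps; blocks drop the last
    vertex and are disjoint, so that counts over them add up. *)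
Definition piece m w i := take m.+1 (drop (i * m) w).
Definition block m w i := take m (drop (i * m) w).

Lemma block_sum (f : seq V -> nat) m w q :
  (forall A B, f A + f B <= f (A ++ B))%N ->
  (\sum_(i < q) f (block m w i) <= f w)%N.
Proof.
move=> fD; elim: q w => [|q IH] w; first by rewrite big_ord0.
rewrite big_ord_recl -[in leqRHS](cat_take_drop m w).
apply: leq_trans (fD _ _); rewrite /block mul0n drop0 leq_add2l.
apply: leq_trans (IH (drop m w)); apply: leq_sum => i _.
by rewrite /block drop_drop lift0 mulSn addnC.
Qed.

Lemma piece_block m w i : ((i * m + m).+1 <= size w)%N ->
  piece m w i = rcons (block m w i) (nth (0 : V) w (i * m + m)%N).
Proof.
move=> le; rewrite /piece /block -(nth_drop (i * m)) -take_nth //.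
by rewrite size_drop; lia.
Qed.

Lemma piece_split m w i : exists A C, w = A ++ piece m w i ++ C.
Proof.
by exists (take (i * m) w), (drop m.+1 (drop (i * m) w)); rewrite !cat_take_drop.
Qed.

End Pieces.

(** * Exponential moments of the number of bad pieces *)

Section BadPieces.
Variables (R : realType) (V : zmodType) (dirs : seq V).
Hypothesis ud : uniq dirs.
Variables (m : nat) (bad : pred (seq V)).
Hypothesis bad_translate : forall z w, bad [seq x + z | x <- w] = bad w.

Definition nbad q w := (\sum_(i < q) bad (piece m w i))%N.

Lemma nbadS q w :
  nbad q.+1 w = (bad (take m.+1 w) + nbad q (shift (drop m w)))%N.
Proof.
rewrite /nbad big_ord_recl /piece mul0n drop0; congr addn.
apply: eq_bigr => i _; rewrite lift0 mulSn addnC -drop_drop /shift.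
by rewrite -map_drop -map_take bad_translate.
Qed.

(** The weight factorises at the cut after the first piece, and [z ^+ b <= 1 + z * b] for a Boolean
    [b]; the last [r] steps carry no weight. *)
Lemma sum_nbad (z : R) q r : 1 <= z ->
  \sum_(w <- saws dirs (q * m + r)) z ^+ nbad q w <=
  ((cn dirs m)%:R + z * (count bad (saws dirs m))%:R) ^+ q * (cn dirs r)%:R.
Proof.
move=> z1; have z0 : 0 <= z by apply: le_trans z1.
elim: q => [|q IH].
  rewrite mul0n add0n expr0 mul1r.
  rewrite (eq_bigr (fun=> 1)) => [|w _]; last by rewrite /nbad big_ord0 expr0.
  by rewrite big_const_seq count_predT iter_addr_0.
rewrite mulSn -addnA exprS -mulrA.
under eq_bigr do rewrite nbadS exprD.
have f0 w : 0 <= z ^+ bad w by rewrite exprn_ge0.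
have g0 w : 0 <= z ^+ nbad q w by rewrite exprn_ge0.
apply: le_trans (sum_cut m (q * m + r) ud f0 g0) _.
apply: ler_pM => //; try by apply: sumr_ge0.
apply: le_trans (_ : \sum_(w <- saws dirs m) (1 + z * (bad w)%:R) <= _).
  apply: ler_sum => w _; case: (bad w); rewrite ?expr1 ?expr0 ?mulr1 ?mulr0 ?addr0 //.
  by rewrite lerDr.
rewrite big_split /= -mulr_sumr big_const_seq count_predT iter_addr_0.
rewrite -natr_sum -sum1_count [in leRHS]big_mkcond /=.
by rewrite (eq_bigr (fun w => if bad w then 1 else 0)%N) // => w _; case: (bad w).
Qed.

(** Markov's inequality with [z = y ^+ 4]: a quarter of bad pieces gives weight at least
    [y ^+ q]. *)
Lemma count_nbad (y : R) q r : 1 <= y ->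
  (count (fun w => q <= 4 * nbad q w)%N (saws dirs (q * m + r)))%:R * y ^+ q <=
  ((cn dirs m)%:R + y ^+ 4 * (count bad (saws dirs m))%:R) ^+ q * (cn dirs r)%:R.
Proof.
move=> y1; have y41 : 1 <= y ^+ 4 by rewrite exprn_ege1.
have y0 : 0 <= y by apply: le_trans y1.
apply: le_trans (sum_nbad q r y41).
rewrite -size_filter mulr_natl.
have -> : y ^+ q *+ size [seq w <- saws dirs (q * m + r) | (q <= 4 * nbad q w)%N] =
    \sum_(w <- saws dirs (q * m + r) | (q <= 4 * nbad q w)%N) y ^+ q.
  by rewrite -[RHS]big_filter big_const_seq count_predT iter_addr_0.
rewrite big_mkcond; apply: ler_sum => w _; case: ifP => [le|_].
  by rewrite -exprM ler_weXn2l.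
by rewrite exprn_ge0 // exprn_ge0.
Qed.

End BadPieces.

Section ManyBad.
Variables (R : realType) (V : zmodType) (dirs : seq V) (mu : R).
Hypothesis ud : uniq dirs.
Hypothesis mu1 : 1 <= mu.
Hypothesis up : forall theta, mu < theta ->
  exists2 C, 0 < C & forall n, (cn dirs n)%:R <= C * theta ^+ n.

(* Pieces of length [m] of a walk are nearly independent: weighting each bad piece
   by [k ^ (- 8 m)] keeps the total weight below [(C k ^ (- m) mu ^ m) ^ q]. *)
Lemma many_bad_pieces (bad : nat -> pred (seq V)) (C1 rho1 : R) (n1 m0 : nat) :
  (forall m z w, bad m [seq x + z | x <- w] = bad m w) ->
  0 < C1 -> 0 < rho1 < mu ->
  (forall m, (n1 <= m)%N -> (count (bad m) (saws dirs m))%:R <= C1 * rho1 ^+ m) ->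
  exists m, [/\ (m0 <= m)%N, (0 < m)%N & exp_small dirs mu
    (fun n w => (n %/ m <= 4 * nbad m (bad m) (n %/ m) w)%N)].
Proof.
move=> badT C10 /andP[r0 r1] badS.
have mu0 : 0 < mu by apply: lt_le_trans mu1.
have rmu : rho1 / mu < 1 by rewrite ltr_pdivrMr // mul1r.
(* The weight [k ^- (8 * m)] of a bad piece is compensated by its rarity. As a quarter of the pieces
   are bad, the gain per piece is [k ^- (2 * m)], which beats the loss [k ^- m] from bounding [cn]
   with the rate [mu / k]. *)
have [k /andP[k0 k1] k8] := near_one_root 8 rmu.
have kN0 : k != 0 by rewrite gt_eqF.
have mut : mu < mu / k by rewrite ltr_pdivlMr // gtr_pMr.
have [C C0 leC] := up mut.
have CC : 0 < C + C1 by apply: addr_gt0.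
have [m2 m2P] := @pow_le_small R k (2 * (C + C1))^-1 (introT andP (conj k0 k1))
  ltac:(by rewrite invr_gt0 mulr_gt0).
pose m := maxn (maxn m0 n1) (maxn m2 1).
have [m0m n1m m2m m1] : [/\ m0 <= m, n1 <= m, m2 <= m & 0 < m]%N.
  by rewrite /m; split; rewrite !leq_max ?leqnn ?orbT.
exists m; split => //.
have [h /andP[h0 h1] hm] := @near_one_root R (2^-1) m ltac:(lra).
(* The power bounds the choices of the last [r < m] steps. [h ^+ m >= 1 / 2] turns the gain 1/2 per
   piece into a rate, and the factor 2 makes up for [h ^+ r]. *)
exists (2 * ((size dirs).+1 ^ m)%:R), (mu * h), 0%N; split.
- by rewrite mulr_gt0 // ltr0n expn_gt0.
- by rewrite mulr_gt0 //= gtr_pMr.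
move=> n _; set q := (n %/ m)%N; set r := (n %% m)%N.
have nE : n = (q * m + r)%N by rewrite /q /r -divn_eq.
have rm : (r < m)%N by rewrite ltn_mod.
rewrite {1}nE [in leRHS]nE; set N := count _ _.
have km0 : 0 < k ^+ m by rewrite exprn_gt0.
have y1 : 1 <= (k ^+ m) ^- 2.
  by rewrite invf_ge1 ?exprn_gt0 // exprn_ile1 ?exprn_ile1 // ltW.
have := count_nbad ud m (badT m) q r y1; rewrite -/N => leN.
have base : (cn dirs m)%:R + ((k ^+ m) ^- 2) ^+ 4 * (count (bad m) (saws dirs m))%:R
    <= (C + C1) * (k ^- m * mu ^+ m).
  rewrite mulrDl; apply: lerD.
    by apply: le_trans (leC m) _; rewrite expr_div_n mulrC [mu ^+ m * _]mulrC mulrC.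
  apply: le_trans (_ : C1 * mu ^+ m <= _); last first.
    rewrite ler_pM2l // ler_peMl ?exprn_ge0 ?(ltW mu0) //.
    by rewrite invf_ge1 // exprn_ile1 // ltW.
  have -> : ((k ^+ m) ^- 2) ^+ 4 = ((k ^+ 8) ^+ m)^-1.
    by rewrite exprVn -!exprM; congr (_ ^+ _)^-1; rewrite -mulnA mulnC.
  rewrite ler_pdivrMl ?exprn_gt0 // mulrCA -exprMn.
  apply: le_trans (badS _ n1m) _; rewrite ler_pM2l //.
  apply: lerXn2r; rewrite ?nnegrE ?(ltW r0) ?mulr_ge0 ?exprn_ge0 ?(ltW mu0) ?(ltW k0) //.
  by rewrite -ler_pdivrMr.
have main : N%:R <= (mu ^+ m / 2) ^+ q * (cn dirs r)%:R.
  have cr0 : 0 <= (cn dirs r)%:R :> R by [].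
  have lhs0 : 0 <= (cn dirs m)%:R + ((k ^+ m) ^- 2) ^+ 4 * (count (bad m) (saws dirs m))%:R.
    by rewrite addr_ge0 // mulr_ge0 // exprn_ge0 // invr_ge0 exprn_ge0 // ltW.
  have rhs0 : 0 <= (C + C1) * (k ^- m * mu ^+ m) by apply: le_trans base.
  have le2 : N%:R * ((k ^+ m) ^- 2) ^+ q <=
      ((C + C1) * (k ^- m * mu ^+ m)) ^+ q * (cn dirs r)%:R.
    by apply: le_trans leN _; rewrite ler_wpM2r // lerXn2r // nnegrE.
  rewrite -(ler_pM2r (_ : 0 < ((k ^+ m) ^- 2) ^+ q)); last first.
    by rewrite exprn_gt0 // invr_gt0 exprn_gt0.
  have base2 : (C + C1) * (k ^- m * mu ^+ m) <= mu ^+ m / 2 * (k ^+ m) ^- 2.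
    have mk : (C + C1) * k ^+ m <= 2^-1.
      have := m2P _ m2m; rewrite -(ler_pM2l CC) => /le_trans; apply.
      by rewrite invfM mulrCA mulfV ?mulr1 // gt_eqF.
    rewrite ler_pdivlMr ?exprn_gt0 //.
    have -> : (C + C1) * (k ^- m * mu ^+ m) * k ^+ m ^+ 2 =
        mu ^+ m * ((C + C1) * k ^+ m) by field; rewrite gt_eqF.
    by rewrite ler_pM2l ?exprn_gt0.
  apply: le_trans le2 _; rewrite [leRHS]mulrAC -[in leRHS]exprMn ler_wpM2r //.
  by apply: lerXn2r => //; rewrite nnegrE; apply: le_trans base2.
apply: le_trans main _.
have hr : 2^-1 <= (mu * h) ^+ r.
  apply: le_trans hm _; apply: le_trans (_ : h ^+ r <= _).
    by apply: ler_wiXn2l; [exact: ltW | exact: ltW | exact: ltnW].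
  by rewrite lerXn2r ?nnegrE ?mulr_ge0 ?(ltW mu0) ?(ltW h0) // ler_peMl // ltW.
have cr : (cn dirs r)%:R <= ((size dirs).+1 ^ m)%N%:R :> R.
  rewrite ler_nat; apply: leq_trans (cn_dirs dirs r) _.
  apply: leq_trans (_ : (size dirs).+1 ^ r <= _)%N; last by rewrite leq_pexp2l // ltnW.
  by case: (r) => // r'; rewrite leq_exp2r.
have hq : (mu ^+ m / 2) ^+ q <= (mu * h) ^+ (q * m).
  rewrite mulnC exprM lerXn2r ?nnegrE ?divr_ge0 ?exprn_ge0 ?mulr_ge0 ?(ltW mu0) ?(ltW h0) //.
  by rewrite exprMn ler_pM2l ?exprn_gt0.
have q0 : 0 <= (mu * h) ^+ (q * m) by rewrite exprn_ge0 // mulr_ge0 // ltW.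
rewrite exprD [leRHS]mulrCA; apply: ler_pM => //.
  by rewrite exprn_ge0 // divr_ge0 // exprn_ge0 // ltW.
apply: le_trans cr _; rewrite mulrAC ler_peMl //; lra.
Qed.

End ManyBad.

(** * Few U-turns are rare *)

Section FewUturns.
Variables (R : realType) (V : zmodType) (dirs : seq V) (mu : R).
Hypothesis dirsN : forall a, a \in dirs -> - a \in dirs.
Hypothesis ud : uniq dirs.
Hypothesis rungs_ex : forall a, a \in dirs -> exists b, (a, b) \in ladder_dirs dirs.
Hypothesis mu1 : 1 <= mu.
Hypothesis up : forall theta, mu < theta ->
  exists2 C, 0 < C & forall n, (cn dirs n)%:R <= C * theta ^+ n.
Implicit Types (w : seq V).

Definition crowded k w v := has (fun Q => k <= count [in Q] w)%N (ladders dirs v).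
Definition crowd k w := count (crowded k w) w.

Lemma crowdedP k w v : reflect
  (exists2 Q, Q \in ladders dirs v & (k <= count [in Q] w)%N) (crowded k w v).
Proof. exact: hasP. Qed.

Lemma crowded_translate k z w v :
  crowded k [seq x + z | x <- w] (v + z) = crowded k w v.
Proof.
wlog suff H : z w v / crowded k w v -> crowded k [seq x + z | x <- w] (v + z).
  apply/idP/idP; last exact: H.
  move/(H (- z)); rewrite addrK -map_comp (@eq_map _ _ _ id) ?map_id //.
  by move=> x /=; rewrite addrK.
case/crowdedP=> _ /mem_ladders[t [a [b [ab -> vQ]]]] le; apply/crowdedP.
have shiftQ x : (x + z \in ladder (t + z) a b) = (x \in ladder t a b).
  have -> : ladder (t + z) a b = [seq x + z | x <- ladder t a b].
    by rewrite -map_comp; apply: eq_map => o /=; rewrite addrAC.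
  by rewrite (mem_map (f := fun x => x + z)) //; exact: addIr.
exists (ladder (t + z) a b).
  by apply/mem_ladders; exists (t + z), a, b; split; rewrite ?shiftQ.
by rewrite count_map (eq_count (a2 := [in ladder t a b])).
Qed.

Lemma crowd_translate k z w : crowd k [seq x + z | x <- w] = crowd k w.
Proof. by rewrite /crowd count_map; apply: eq_count => v /=; exact: crowded_translate. Qed.

(* Induction hypothesis on [k] of the pattern theorem: few U-turns force many
   ladders to be visited at least [k] times. For [k = 7] this is impossible. *)
Definition rarely_uncrowded k : Prop := exists eps delta : R,
  [/\ 0 < eps, 0 < delta & exp_small dirs mu (fun n w =>
    ((nU dirs w)%:R < eps * n%:R) && ((crowd k w)%:R < delta * n%:R))].

(** By [rungs_ex] each edge lies in a ladder, so every vertex of a walk with at least one step is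
    crowded and the event is empty. *)
Lemma rarely_uncrowded2 : rarely_uncrowded 2.
Proof.
exists 1, 1; split => //; exists 1, (mu / 2), 1%N.
have mu0 : 0 < mu by apply: lt_le_trans mu1.
split => //; first by lra.
move=> n n1; set N := count _ _; suff -> : N = 0%N.
  by rewrite mulr_ge0 // exprn_ge0 // divr_ge0 // ltW.
apply/eqP; rewrite /N -leqn0 leqNgt -has_count; apply/hasPn => w.
rewrite mem_saws => /and3P[/eqP sw _ /andP[_ srt]].
rewrite negb_and -!leNgt !mul1r; apply/orP; right.
rewrite ler_nat; apply: leq_trans (_ : size w <= _)%N; first by rewrite sw.
apply/eq_leq/esym/eqP; rewrite /crowd -all_count; apply/allP => v vw.
have [A [x [y [B [wE vxy]]]]] : exists A x y B,
    w = A ++ [:: x, y & B] /\ (v == x) || (v == y).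
  case/splitPr: vw sw {srt} => A [|y B] sw; last by exists A, v, y, B; rewrite eqxx.
  case/lastP: A sw => [|A x] sw; first by move: sw n1 => /= [<-].
  by exists A, x, v, [::]; rewrite cat_rcons eqxx orbT.
have axy : adj dirs x y.
  by move: srt; rewrite wE => /cat_sorted2[_ /= /andP[]].
have [b abP] := rungs_ex axy.
have [xQ yQ] : x \in ladder x (y - x) b /\ y \in ladder x (y - x) b.
  split; rewrite /ladder !inE; first by rewrite addr0 eqxx.
  have e : x + (y - x) = y by rewrite addrC addrNK.
  by rewrite e eqxx /= orbT.
apply/crowdedP; exists (ladder x (y - x) b).
  apply/mem_ladders; exists x, (y - x), b; split => //.
  by case/orP: vxy => /eqP ->.
by rewrite wE count_cat /= xQ yQ !add1n addnS addnS.
Qed.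

Lemma crowd7 w : saw dirs w -> crowd 7 w = 0%N.
Proof.
move=> /andP[uw _]; apply/eqP; rewrite -leqn0 leqNgt -has_count.
apply/hasPn => v _; apply/crowdedP => -[Q Qv]; apply/negP; rewrite -leqNgt.
rewrite -(size_ladder Qv) -size_filter; apply: uniq_leq_size.
  exact: filter_uniq.
by move=> u; rewrite mem_filter => /andP[].
Qed.

Lemma window_ends Q w : (1 < count [in Q] w)%N ->
  exists A x B y C, [/\ w = A ++ (x :: rcons B y) ++ C, x \in Q, y \in Q,
    avoids Q A & avoids Q C].
Proof.
move=> c2; have hw : has [in Q] w by rewrite has_count ltnW.
case/split_find: {-}_ / hw (c2) => x A C xQ AQ.
rewrite cat_rcons count_cat /= xQ.
have /eqP -> : count [in Q] A == 0%N by rewrite eqn0Ngt -has_count.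
rewrite add0n add1n ltnS -has_count -has_rev => hC.
have [C' CE] : exists C', C = rev C' by exists (rev C); rewrite revK.
rewrite CE revK in hC *; case/split_find: {-}_ / hC => y D B yQ DQ.
exists A, x, (rev B), y, (rev D); split => //.
  by rewrite rev_cat rev_rcons /= cat_rcons.
by rewrite /avoids has_rev.
Qed.

(** The piece makes [k] visits to the ladder and the whole walk at most [k]; hence there are none
    outside the piece, whose size bounds the window. *)
Lemma piece_available k m w i v : saw dirs w -> (1 < k)%N ->
  v \in block m w i -> crowded k (piece m w i) v -> ~~ crowded k.+1 w v ->
  available dirs m w v.
Proof.
move=> sw k1 vb /crowdedP[Q Qv kQ] ncr.
have [A [C wE]] := piece_split m w i.
have cw : (count [in Q] w <= k)%N.
  by rewrite leqNgt; apply: contra ncr => kQw; apply/crowdedP; exists Q.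
have [cA cC] : count [in Q] A = 0%N /\ count [in Q] C = 0%N.
  by move: cw; rewrite {1}wE !count_cat; lia.
have [A' [x [B [y [C' [pE xQ yQ A'Q C'Q]]]]]] := window_ends (leq_trans k1 kQ).
have vp : v \in piece m w i.
  by move: vb; rewrite /block -(take_takel _ (leqnSn m)) => /mem_take.
exists Q, (A ++ A'), x, B, y, (C' ++ C); split.
- by rewrite {1}wE pE -!catA.
- have vQ : v \in Q by move/mem_ladders: Qv => [? [? [? []]]].
  move: vp; rewrite pE !mem_cat => /or3P[vA||vC] //.
    by move/hasPn: A'Q => /(_ v vA); rewrite /= vQ.
  by move/hasPn: C'Q => /(_ v vC); rewrite /= vQ.
- have : (size (piece m w i) <= m.+1)%N.
    by rewrite /piece size_take; case: ltnP.
  by rewrite pE !size_cat /= size_rcons; clear; move: (size _) (size _) (size _) => *; lia.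
rewrite /avoids in A'Q C'Q *; split; rewrite // has_cat negb_or.
  by rewrite A'Q andbT has_count cA.
by rewrite C'Q has_count cC.
Qed.

(** When the first three terms vanish or stay small, some vertex of the block is available. The
    constants 8 and 2 absorb the vertex that the piece has beyond the block: it accounts for at most
    4 U-turns and one crowded vertex. *)
Lemma block_alternative (eps delta : R) k m w i : saw dirs w -> (1 < k)%N ->
  8 <= eps * m%:R -> 2 <= delta * m%:R -> ((i * m + m).+1 <= size w)%N ->
  1 <= (((nU dirs (piece m w i))%:R < eps * m%:R) &&
        ((crowd k (piece m w i))%:R < delta * m%:R))%:R
     + 2 / (eps * m%:R) * (nU dirs (block m w i))%:R
     + (count (crowded k.+1 w) (block m w i))%:R
     + (count (fun v => `[< available dirs m w v >]) (block m w i))%:R.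
Proof.
move=> sw k1 em dm im; have em0 : 0 < eps * m%:R by apply: lt_le_trans em.
have U0 : 0 <= 2 / (eps * m%:R) * (nU dirs (block m w i))%:R.
  by rewrite mulr_ge0 // divr_ge0 // ltW.
set c1 := count (crowded _ _) _; set c2 := count _ _.
have c10 : 0 <= c1%:R :> R by []; have c20 : 0 <= c2%:R :> R by [].
case: (ltP (nU dirs (piece m w i))%:R) => /= Ule; last first.
  have U1 : 1 <= 2 / (eps * m%:R) * (nU dirs (block m w i))%:R.
    rewrite mulrAC ler_pdivlMr // mul1r.
    have : (nU dirs (piece m w i))%:R <= (nU dirs (block m w i) + 4)%N%:R :> R.
      rewrite ler_nat (piece_block im) -cats1; apply: leq_trans (nU_cat_le _ _ _) _.
      by rewrite -addnA leq_add2l; apply: (@leq_add _ _ 1 3); rewrite ?nU_size.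
    rewrite natrD; lra.
  lra.
case: ltP => cle /=; first by lra.
have : (0 < c1 + c2)%N; last by rewrite -(ler_nat R) natrD; lra.
have : (2 <= crowd k (piece m w i))%N by rewrite -(ler_nat R); apply: le_trans cle.
rewrite {1}/crowd {2}(piece_block im) -cats1 count_cat /= addn0.
move=> c2'; have : has (crowded k (piece m w i)) (block m w i).
  by rewrite has_count; case: (count _ _) c2' => //; case: (crowded _ _ _).
case/hasP=> v vb vk; case vS: (crowded k.+1 w v).
  have : (0 < c1)%N by rewrite -has_count; apply/hasP; exists v.
  by case: (c1).
have : (0 < c2)%N.
  rewrite -has_count; apply/hasP; exists v => //; apply/asboolP.
  by apply: piece_available vb vk _; rewrite ?vS.
by case: (c2) => // *; rewrite addnS.
Qed.

(* Most pieces of a typical walk visit some ladder [k] times by themselves. If few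
   ladders are visited [k.+1] times by the whole walk, then for most pieces no
   other part of the walk visits that ladder, which is thus available. *)
Lemma rarely_uncrowdedS k : (1 < k)%N ->
  rarely_uncrowded k -> rarely_uncrowded k.+1.
Proof.
move=> k1 [eps [delta [e0 d0 [C1 [rho1 [n1 [C10 r1 H1]]]]]]].
pose bad m u := ((nU dirs u)%:R < eps * m%:R) && ((crowd k u)%:R < delta * m%:R).
have badT m z w : bad m [seq x + z | x <- w] = bad m w.
  by rewrite /bad nU_shift crowd_translate.
have [m [m0m m0 Bm]] := many_bad_pieces ud mu1 up
  (maxn (Num.bound (8 / eps)) (Num.bound (2 / delta))) badT C10 r1 H1.
have mR : 0 < m%:R :> R by rewrite ltr0n.
have em : 8 <= eps * m%:R.
  rewrite mulrC -ler_pdivrMr // ltW //.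
  apply: lt_le_trans (_ : (Num.bound (8 / eps))%:R <= _).
    by apply: archi_boundP; rewrite divr_ge0 // ltW.
  by rewrite ler_nat; apply: leq_trans m0m; rewrite leq_maxl.
have dm : 2 <= delta * m%:R.
  rewrite mulrC -ler_pdivrMr // ltW //.
  apply: lt_le_trans (_ : (Num.bound (2 / delta))%:R <= _).
    by apply: archi_boundP; rewrite divr_ge0 // ltW.
  by rewrite ler_nat; apply: leq_trans m0m; rewrite leq_maxr.
have tau0 : 0 < (8 * m%:R)^-1 :> R by rewrite invr_gt0 mulr_gt0.
have [eps2 [C2 [rho2 [n2 [e20 C20 r2 H2]]]]] :=
  nU_or_avails_rare dirsN ud mu1 up m tau0.
(* As [n < 2 * q * m], bad pieces, U-turns and crowded vertices account for at most [q / 4] each.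
   More than [q / 4], hence more than [n / (8 * m)], vertices are then available. *)
exists (Num.min (eps / 16) eps2), (8 * m%:R)^-1; split => //.
  by rewrite lt_min e20 divr_gt0.
apply: (exp_smallU (n1 := m) Bm).
  by exists C2, rho2, n2; split; [exact: C20 | exact: r2 | exact: H2].
move=> n w mn; rewrite mem_saws => /and3P[/eqP sizew _ sw].
case/andP; rewrite (minr_pMl _ _ (ler0n _ _)) lt_min => /andP[Ue Ue2] cr.
rewrite Ue2 /= -implyNb -ltnNge; apply/implyP => nb.
set q := (n %/ m)%N in nb *.
have q0 : (0 < q)%N by rewrite divn_gt0.
have qn : (q * m <= n)%N by exact: leq_divM.
have n2q : (n < 2 * (q * m))%N.
  rewrite {1}(divn_eq n m) -/q mul2n -addnn ltn_add2l.
  by apply: leq_trans (ltn_pmod n m0) _; rewrite leq_pmull.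
have n2qR : n%:R < 2 * (q%:R * m%:R) :> R by rewrite -!natrM ltr_nat.
have main : q%:R <= (nbad m (bad m) q w)%:R + 2 / (eps * m%:R) * (nU dirs w)%:R +
    (crowd k.+1 w)%:R + (size (avails dirs m w))%:R.
  have -> : q%:R = \sum_(i < q) 1 :> R by rewrite big_const_ord iter_addr_0.
  apply: le_trans.
    apply: ler_sum => i _; apply: (block_alternative (i := i) sw k1 em dm).
    rewrite sizew ltnS -mulSnr; apply: leq_trans qn.
    by rewrite leq_mul2r ltn_ord orbT.
  rewrite !big_split /= -!mulr_sumr -!natr_sum.
  have em0 : 0 < eps * m%:R by apply: lt_le_trans em.
  apply: lerD; [apply: lerD; [apply: lerD|]|].
  - by rewrite /nbad lexx.
  - rewrite ler_wpM2l ?divr_ge0 ?(ltW em0) // ler_nat; apply: block_sum.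
    exact: nU_cat_ge.
  - rewrite ler_nat; apply: (block_sum (f := count _)) => A B.
    by rewrite count_cat.
  - rewrite ler_nat size_filter; apply: (block_sum (f := count _)) => A B.
    by rewrite count_cat.
have U4 : 2 / (eps * m%:R) * (nU dirs w)%:R <= q%:R / 4.
  rewrite mulrAC ler_pdivrMr; last by rewrite mulr_gt0.
  have : eps * n%:R <= eps * (2 * (q%:R * m%:R)) by rewrite ler_pM2l // ltW.
  lra.
have c4 : (crowd k.+1 w)%:R <= q%:R / 4 :> R.
  apply: le_trans (ltW cr) _; rewrite ler_pdivrMl ?mulr_gt0 //; lra.
have b4 : (nbad m (bad m) q w)%:R < q%:R / 4 :> R.
  by rewrite ltr_pdivlMr // -natrM ltr_nat mulnC.
rewrite ler_pdivrMl ?mulr_gt0 //.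
have : 8 * m%:R * (q%:R / 4) <= 8 * m%:R * (size (avails dirs m w))%:R :> R.
  by rewrite ler_pM2l ?mulr_gt0 //; lra.
lra.
Qed.

Lemma few_uturns_rare : exists2 eps : R, 0 < eps &
  exp_small dirs mu (fun n w => (nU dirs w)%:R < eps * n%:R).
Proof.
have H7 : rarely_uncrowded 7 by do 5!apply: rarely_uncrowdedS => //; exact: rarely_uncrowded2.
have [eps [delta [e0 d0 H]]] := H7; exists eps => //.
apply: (exp_small_sub (n1 := 1) H) => n w n0; rewrite mem_saws => /and3P[_ _ sw] ->.
by rewrite (crowd7 sw) mulr_gt0 // ltr0n.
Qed.

End FewUturns.

(** * Free slots *)

Section Slots.
Variables (V : zmodType) (dirs : seq V).
Implicit Types (x y u v t : V) (A B Z w E X : seq V).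
Local Notation adj := (adj dirs).

Definition pairs Z := zip Z (behead Z).

Lemma pairs_cat A x B : pairs (A ++ x :: B) = pairs (rcons A x) ++ pairs (x :: B).
Proof.
elim: A => //= a A IH.
have pc b Y : pairs [:: a, b & Y] = (a, b) :: pairs (b :: Y) by [].
case: A IH => [|a' A] /= IH; first by rewrite pc.
by rewrite !pc IH.
Qed.

Lemma uniq_pairs Z : uniq Z -> uniq (pairs Z).
Proof. exact: zip_uniql. Qed.

Lemma size_pairs Z : (size (pairs Z) <= size Z)%N.
Proof. by rewrite size_zip geq_minl. Qed.

Lemma mem_pairs Z x y : reflect (exists A B, Z = A ++ [:: x, y & B])
  ((x, y) \in pairs Z).
Proof.
apply: (iffP idP) => [|[A [B ->]]]; last first.
  by rewrite pairs_cat mem_cat inE eqxx orbT.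
elim: Z => //= z Z IH; case: Z IH => //= z' Z IH.
rewrite inE => /orP[/eqP[-> ->]|/IH[A [B ->]]]; first by exists [::], Z.
by exists (z :: A), B.
Qed.

Lemma pairs_rev Z x y : ((x, y) \in pairs (rev Z)) = ((y, x) \in pairs Z).
Proof.
wlog suff H : Z x y / (x, y) \in pairs (rev Z) -> (y, x) \in pairs Z.
  by apply/idP/idP => [/H //|h]; apply: H; rewrite revK.
move=> /mem_pairs[A [B ZE]]; apply/mem_pairs; exists (rev B), (rev A).
by rewrite -(revK Z) ZE rev_cat !rev_cons !cat_rcons.
Qed.

Definition dirs2 := [seq (a, b) | a <- dirs, b <- dirs].
Definition dirs3 := [seq (a, bc) | a <- dirs, bc <- dirs2].

(* [((x, y), (u, v))] is an edge [x - y] of [Z] that can be replaced by the detour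
   [x - u - v - y], the vertices [u] and [v] being off [w]. *)
Definition slots Z w :=
  [seq s <- [seq (e, (e.1 + ab.1, e.1 + ab.1 + ab.2)) | e <- pairs Z, ab <- dirs2] |
    [&& adj s.2.2 s.1.2, s.2.1 \notin w & s.2.2 \notin w]].
Definition nF Z w := size (slots Z w).

Lemma mem_slots Z w x y u v : ((x, y), (u, v)) \in slots Z w =
  [&& (x, y) \in pairs Z, adj x u, adj u v, adj v y, u \notin w & v \notin w].
Proof.
rewrite mem_filter /=.
case: (adj v y); case: (u \in w); case: (v \in w); rewrite /= ?andbF ?andbT //.
apply/allpairsPdep/and3P => [[e [[a b] [eZ + [ex -> ->]]]]|[eZ xu uv]].
  move=> /allpairsPdep[a' [b' [aP bP [ea eb]]]]; subst a' b'; rewrite -ex /=.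
  by split; rewrite ?ex //; [exact: adj_step | exact: adj_step].
exists (x, y), (u - x, v - u); split => //.
  by apply/allpairsPdep; exists (u - x), (v - u).
have e (a b : V) : a + (b - a) = b by rewrite addrCA subrr addr0.
by rewrite /= !e.
Qed.

Lemma uniq_slots Z w : uniq dirs -> uniq Z -> uniq (slots Z w).
Proof.
move=> ud uZ; apply: filter_uniq; apply: allpairs_uniq.
- exact: uniq_pairs.
- by apply: allpairs_uniq => // -[? ?] [? ?] _ _ [-> ->].
move=> [e [a b]] [e' [a' b']] _ _ /= [ee]; rewrite ee.
by move=> /addrI -> /addrI ->.
Qed.

Lemma size_dirs2 : size dirs2 = (size dirs ^ 2)%N.
Proof. by rewrite size_allpairs mulnn. Qed.

Lemma size_dirs3 : size dirs3 = (size dirs ^ 3)%N.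
Proof. by rewrite size_allpairs size_dirs2 -expnS. Qed.

Lemma nF_size Z w : (nF Z w <= size Z * size dirs ^ 2)%N.
Proof.
rewrite /nF size_filter; apply: leq_trans (count_size _ _) _.
by rewrite size_allpairs size_dirs2 leq_mul2r size_pairs orbT.
Qed.

(** For [e] lost edges and [x] new vertices: two directions determine a slot on a given edge, and
    three determine a slot with a given vertex as [u] or as [v]. *)
Definition slot_loss (e x : nat) := (e * size dirs ^ 2 + 2 * x * size dirs ^ 3)%N.

Lemma nF_le Z w Z' w' (E : seq (V * V)) X : uniq dirs -> uniq Z ->
  (forall e, e \in pairs Z -> e \in pairs Z' \/ e \in E) ->
  (forall t, t \in w' -> t \in w \/ t \in X) ->
  (nF Z w <= nF Z' w' + slot_loss (size E) (size X))%N.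
Proof.
move=> ud uZ ZE wX.
pose newE := [seq (e, (e.1 + ab.1, e.1 + ab.1 + ab.2)) | e <- E, ab <- dirs2].
pose new1 := [seq ((z - a.1, z + a.2.1 + a.2.2), (z, z + a.2.1)) | z <- X, a <- dirs3].
pose new2 := [seq ((z - a.2.1 - a.1, z + a.2.2), (z - a.2.1, z)) | z <- X, a <- dirs3].
have -> : slot_loss (size E) (size X) = size (newE ++ new1 ++ new2).
  rewrite !size_cat [size newE]size_allpairs [size new1]size_allpairs.
  by rewrite [size new2]size_allpairs size_dirs2 size_dirs3 /slot_loss mul2n -addnn mulnDl.
rewrite -size_cat; apply: uniq_leq_size; first exact: uniq_slots.
move=> [[x y] [u v]]; rewrite mem_slots => /and5P[eZ xu uv vy /andP[uw vw]].
have e (a b : V) : a + (b - a) = b by rewrite addrCA subrr addr0.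
have e' (a b : V) : b - (b - a) = a by rewrite opprB addrC addrNK.
have d2 : (u - x, v - u) \in dirs2.
  by apply/allpairsPdep; exists (u - x), (v - u).
have d3 : (u - x, (v - u, y - v)) \in dirs3.
  apply/allpairsPdep; exists (u - x), (v - u, y - v); split => //.
  by apply/allpairsPdep; exists (v - u), (y - v).
rewrite !mem_cat; case: (boolP (u \in w')) => [uw'|uw'].
  have [|uX] := wX _ uw'; first by rewrite (negbTE uw).
  apply/orP; right; apply/orP; right; apply/orP; left; apply/allpairsPdep.
  by exists u, (u - x, (v - u, y - v)); split; rewrite //= !e e'.
case: (boolP (v \in w')) => [vw'|vw'].
  have [|vX] := wX _ vw'; first by rewrite (negbTE vw).
  do 3!(apply/orP; right); apply/allpairsPdep.
  by exists v, (u - x, (v - u, y - v)); split; rewrite //= !e !e'.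
have [eZ'|eE] := ZE _ eZ.
  by rewrite mem_slots eZ' xu uv vy uw' vw'.
apply/orP; right; apply/orP; left; apply/allpairsPdep.
by exists (x, y), (u - x, v - u); split; rewrite //= !e.
Qed.

Lemma nF_rev Z w w' : (forall a, a \in dirs -> - a \in dirs) -> uniq dirs ->
  uniq Z -> w =i w' -> nF (rev Z) w' = nF Z w.
Proof.
move=> dN ud.
wlog suff H : Z w w' / uniq Z -> w =i w' -> (nF Z w <= nF (rev Z) w')%N.
  move=> uZ ww; apply/eqP; rewrite eqn_leq H // andbT -{2}(revK Z) H ?rev_uniq //.
move=> uZ ww; rewrite /nF.
rewrite -(size_map (fun s : (V * V) * (V * V) => ((s.1.2, s.1.1), (s.2.2, s.2.1)))).
apply: uniq_leq_size.
  rewrite map_inj_uniq ?uniq_slots // => -[[x y] [u v]] [[x' y'] [u' v']] /=.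
  by case=> -> -> -> ->.
move=> s /mapP[[[x y] [u v]] + ->] /=; rewrite !mem_slots.
move=> /and5P[eZ xu uv vy /andP[uw vw]].
have sym := adj_sym dN.
by rewrite pairs_rev eZ (sym y v) vy (sym v u) uv (sym u x) xu -!ww uw vw.
Qed.

Lemma uniq_cut x A B A' B' : uniq (A ++ x :: B) ->
  A ++ x :: B = A' ++ x :: B' -> A = A' /\ B = B'.
Proof.
move=> un E; have sA : size A = size A'.
  have nx C D : uniq (C ++ x :: D) -> index x (C ++ x :: D) = size C.
    rewrite cat_uniq /= negb_or => /and3P[_ /andP[/negbTE xC _] _].
    by rewrite index_cat xC /= eqxx addn0.
  by rewrite -(nx A B) // E nx // -E.
by move/eqP: E; rewrite eqseq_cat // => /andP[/eqP -> /eqP[->]].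
Qed.

Lemma pairs_bump A x u v y B :
  (forall e, e \in pairs (A ++ [:: x, y & B]) ->
    e \in pairs (A ++ [:: x, u, v, y & B]) \/ e \in [:: (x, y)]) /\
  (forall e, e \in pairs (A ++ [:: x, u, v, y & B]) ->
    e \in pairs (A ++ [:: x, y & B]) \/ e \in [:: (x, u); (u, v); (v, y)]).
Proof.
have pc a b Y : pairs [:: a, b & Y] = (a, b) :: pairs (b :: Y) by [].
split=> e; rewrite !pairs_cat !pc !mem_cat !inE.
  by case/or3P=> ->; rewrite ?orbT; [left | right | left].
by case/or4P=> [->|->|->|/orP[->|->]]; rewrite ?orbT; [left|right|right|right|left].
Qed.

(** The constants are 4 + 3 + 3 and 2 + 3 + 3: the size of the middle part and the two junctions. *)
Lemma nU_bump A x u v y B :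
  (nU dirs (A ++ [:: x, u, v, y & B]) <= nU dirs (A ++ [:: x, y & B]) + 10)%N /\
  (nU dirs (A ++ [:: x, y & B]) <= nU dirs (A ++ [:: x, u, v, y & B]) + 8)%N.
Proof.
have := nU_cat_le dirs A [:: x, u, v, y & B].
have := nU_cat_le dirs [:: x; u; v; y] B; have := nU_size dirs [:: x; u; v; y].
have := nU_cat_ge dirs A [:: x, u, v, y & B].
have := nU_cat_ge dirs [:: x; u; v; y] B.
have := nU_cat_le dirs A [:: x, y & B].
have := nU_cat_le dirs [:: x; y] B; have := nU_size dirs [:: x; y].
have := nU_cat_ge dirs A [:: x, y & B].
have := nU_cat_ge dirs [:: x; y] B.
rewrite /=.
move: (nU dirs (A ++ [:: x, y & B])) (nU dirs (A ++ [:: x, u, v, y & B])).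
move: (nU dirs [:: x, y & B]) (nU dirs [:: x, u, v, y & B]).
move: (nU dirs [:: x; y]) (nU dirs [:: x; u; v; y]) (nU dirs A) (nU dirs B).
by clear => *; lia.
Qed.

End Slots.

(** * Cutting off U-turns in a part of the walk *)

Section BumpRemoval.
Variables (V : zmodType) (dirs : seq V).
Hypothesis dirsN : forall a, a \in dirs -> - a \in dirs.
Hypothesis ud : uniq dirs.
Implicit Types (x y u v t : V) (A B Z w L T : seq V).
Local Notation adj := (adj dirs).

Lemma saw_unbump A x u v y B : saw dirs (A ++ [:: x, u, v, y & B]) -> adj x y ->
  saw dirs (A ++ [:: x, y & B]).
Proof.
move=> /andP[un srt] xy; apply/andP; split.
  apply: subseq_uniq un; apply: cat_subseq => //.
  by apply: (@cat_subseq _ [:: x] (y :: B) [:: x; u; v] (y :: B)); rewrite //= eqxx.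
apply: (@sorted_splice _ dirs A B x y [:: u; v] [:: y]) => //=.
by rewrite xy.
Qed.

Lemma saw_bump A x u v y B : saw dirs (A ++ [:: x, y & B]) ->
  adj x u -> adj u v -> adj v y -> u != v ->
  u \notin A ++ [:: x, y & B] -> v \notin A ++ [:: x, y & B] ->
  saw dirs (A ++ [:: x, u, v, y & B]).
Proof.
move=> /andP[un srt] xu uv vy nuv uw vw; apply/andP; split.
  have p : perm_eq (A ++ [:: x, u, v, y & B]) [:: u, v & A ++ [:: x, y & B]].
    apply/permP => P; rewrite /= !count_cat /=.
    move: (count P A) (count P B) (nat_of_bool (P x)) (nat_of_bool (P y)).
    by move: (nat_of_bool (P u)) (nat_of_bool (P v)); clear => *; lia.
  by rewrite (perm_uniq p) /= inE negb_or nuv uw vw un.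
apply: (@sorted_splice _ dirs A B x y [::] [:: u; v; y]) => //=.
by rewrite xu uv vy.
Qed.

(** Delimited from both ends, since cutting off a U-turn inside changes the length but neither [l]
    nor [r]. *)
Definition middle l r w := take (size w - l - r) (drop l w).

Lemma middle_cat L Z T : middle (size L) (size T) (L ++ Z ++ T) = Z.
Proof. by rewrite /middle drop_size_cat // !size_cat addKn addnK take_size_cat. Qed.

Lemma middle_split l r w p : p \in uturns dirs (middle l r w) ->
  exists L T, [/\ w = L ++ middle l r w ++ T, size L = l & size T = r].
Proof.
rewrite mem_uturns => /andP[sp _]; exists (take l w), (drop (size w - l - r) (drop l w)).
have := sp; rewrite /middle size_take size_drop => sz.
have szl : (l + r <= size w)%N by move: sz; clear; case: ifP; lia.
rewrite !cat_take_drop; split => //; first by rewrite size_takel //; lia.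
by rewrite !size_drop; lia.
Qed.

Definition unbump l r w (p : nat) w' (k : (V * V) * (V * V)) : Prop :=
  exists L A x u v y B T, [/\ w = L ++ (A ++ [:: x, u, v, y & B]) ++ T,
    [/\ size L = l, size T = r & size A = p], adj x y /\ uniq w',
    w' = L ++ (A ++ [:: x, y & B]) ++ T & k = ((x, y), (u, v))].

(** The vertices of [w'] are distinct, so the edge [x - y] occurs once and tells where the detour
    goes back. *)
Lemma unbump_inj l r w1 p1 w2 p2 w' k :
  unbump l r w1 p1 w' k -> unbump l r w2 p2 w' k -> w1 = w2 /\ p1 = p2.
Proof.
move=> [L [A [x [u [v [y [B [T [-> [sL sT <-] [_ un] wE kE1]]]]]]]]].
move=> [L2 [A2 [x2 [u2 [v2 [y2 [B2 [T2 [-> [sL2 sT2 <-] _ wE2 kE]]]]]]]]].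
have sz : size (A ++ [:: x, y & B]) = size (A2 ++ [:: x2, y2 & B2]).
  have := congr1 size wE; rewrite wE2 !size_cat sL sL2 sT sT2.
  by move: (size A) (size A2) (size _) (size _); clear => *; lia.
have := wE2; rewrite wE => /eqP; rewrite eqseq_cat ?sL ?sL2 // => /andP[/eqP <-].
rewrite eqseq_cat // => /andP[/eqP ABE /eqP TE].
move: kE; rewrite kE1 => -[e1 e2 e3 e4]; subst x2 y2 u2 v2 T2.
move: un; rewrite wE cat_uniq => /and3P[_ _]; rewrite cat_uniq => /andP[uAB _].
by have [-> [->]] := uniq_cut uAB ABE.
Qed.

Lemma unbump_exists l r w p : saw dirs w -> p \in uturns dirs (middle l r w) ->
  exists w' k, unbump l r w p w' k /\ k \in slots dirs (middle l r w') w'.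
Proof.
move=> sw pU; have [L [T [wE sL sT]]] := middle_split pU.
move: pU; rewrite mem_uturns => /uturnP[A [x [u [v [y [B [ZE sA xy]]]]]]].
rewrite ZE in wE; pose w' := L ++ (A ++ [:: x, y & B]) ++ T.
have sw' : saw dirs w'.
  rewrite /w' -catA catA; apply: (@saw_unbump _ x u v y) => //=.
  by move: sw; rewrite wE -!catA.
exists w', ((x, y), (u, v)); split.
  by exists L, A, x, u, v, y, B, T; split => //; split => //; case/andP: sw'.
have mE : middle l r w' = A ++ [:: x, y & B] by rewrite -sL -sT middle_cat.
rewrite mE mem_slots; apply/and5P; split.
- by apply/mem_pairs; exists A, B.
- by case/andP: sw => _; rewrite wE => /cat_sorted2[_ /cat_sorted2[]] /cat_sorted2[_ /and3P[]].
- by case/andP: sw => _; rewrite wE => /cat_sorted2[_ /cat_sorted2[]] /cat_sorted2[_ /and3P[]].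
- by case/andP: sw => _; rewrite wE => /cat_sorted2[_ /cat_sorted2[]] /cat_sorted2[_ /and4P[]].
have : uniq ([:: u; v] ++ w').
  case/andP: sw => un _; rewrite (perm_uniq (s2 := w)) //.
  apply/permP => P; rewrite wE /w' /= !count_cat /=.
  move: (count P A) (count P B) (count P L) (count P T).
  move: (nat_of_bool (P x)) (nat_of_bool (P y)) (nat_of_bool (P u)) (nat_of_bool (P v)).
  by clear => *; lia.
by rewrite /= inE negb_or -!andbA => /and4P[_ -> ->].
Qed.

Lemma unbump_rooted l r w p w' k : rooted_saw dirs w -> unbump l r w p w' k ->
  rooted_saw dirs w' /\ (size w' <= size w)%N.
Proof.
move=> /and3P[_ hw sw] [L [A [x [u [v [y [B [T [wE _ [xy _] w'E _]]]]]]]]].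
have sw' : saw dirs w'.
  rewrite w'E -catA catA; apply: (@saw_unbump _ x u v y) => //=.
  by move: sw; rewrite wE -!catA.
split; last by rewrite wE w'E !size_cat /= !leq_add2l leq_add2r leq_add2l; lia.
apply/and3P; split => //; first by rewrite w'E; case: (L) => //; case: (A).
by move: hw; rewrite wE w'E; case: (L) => //; case: (A).
Qed.

Lemma unbump_counts l r w p w' k : saw dirs w -> unbump l r w p w' k ->
  (nU dirs (middle l r w) <= nU dirs (middle l r w') + 10)%N /\
  (nF dirs (middle l r w') w' <= nF dirs (middle l r w) w + slot_loss dirs 1 2)%N.
Proof.
move=> sw [L [A [x [u [v [y [B [T [wE [<- <- _] [_ uw'] w'E _]]]]]]]]].
rewrite {1 2}wE {1 2}w'E !middle_cat; split; first by case: (nU_bump dirs A x u v y B).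
apply: (@nF_le _ dirs _ w' _ w [:: (x, y)] [:: u; v]) => //.
- by move: uw'; rewrite w'E cat_uniq => /and3P[_ _]; rewrite cat_uniq => /andP[].
- by case: (pairs_bump A x u v y B).
move=> t; rewrite wE w'E !mem_cat !inE.
by do !case: (_ == _); do !case: (_ \in _); rewrite ?orbT; auto.
Qed.

(** [switching] with U-turns as moves and slots as marks, one code per slot; [G = 0] since walks get
    shorter. *)
Lemma few_slots_rare (R : realType) (mu : R) : 1 <= mu ->
  (forall theta, mu < theta ->
    exists2 C, 0 < C & forall n, (cn dirs n)%:R <= C * theta ^+ n) ->
  forall tau : R, 0 < tau ->
  exists (eps : R), 0 < eps /\ forall l r : nat -> nat,
    exp_small dirs mu (fun n w =>
      ((nF dirs (middle (l n) (r n) w) w)%:R < eps * n%:R) &&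
      (tau * n%:R <= (nU dirs (middle (l n) (r n) w))%:R)).
Proof.
move=> mu1 up tau tau0.
have [eps [C [rho [n0 [e0 C0 r0 H]]]]] := switching mu1 up ud
  10 (slot_loss dirs 1 2) 1 0 tau0.
exists eps; split => // l r; exists C, rho, n0; split => // n nn0.
apply: (H _ _ (fun w => uturns dirs (middle (l n) (r n) w))
  (fun w => slots dirs (middle (l n) (r n) w) w) (unbump (l n) (r n))
  (fun w => nF dirs (middle (l n) (r n) w) w)) => //.
- by move=> w _; exact: uniq_uturns.
- by move=> w; rewrite mul1n.
- by move=> w p /and3P[_ _ sw]; exact: unbump_exists.
- move=> w p w' k rw _ st; have [rw' sz] := unbump_rooted rw st.
  have [|h1 h2] := unbump_counts _ st; first by case/and3P: rw.
  by split; rewrite ?addn0.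
- by move=> *; apply: unbump_inj; eassumption.
Qed.

End BumpRemoval.

(** * Moving the time at which a vertex is visited *)

Section Transfer.
Variables (V : zmodType) (dirs : seq V).
Hypothesis dirsN : forall a, a \in dirs -> - a \in dirs.
Hypothesis dirs0 : 0 \notin dirs.
Hypothesis ud : uniq dirs.
Variable x : V.
Implicit Types (u v t : V) (A B Z w P S : seq V).
Local Notation adj := (adj dirs).

Definition upto w := take (index x w).+1 w.
Definition from w := drop (index x w) w.

Lemma upto_cat P S : uniq (rcons P x ++ S) -> upto (rcons P x ++ S) = rcons P x.
Proof.
rewrite cat_uniq rcons_uniq => /andP[/andP[xP _] _].
rewrite /upto cat_rcons index_cat (negbTE xP) /= eqxx addn0 -cat_rcons.
by rewrite take_size_cat // size_rcons.
Qed.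

Lemma from_cat P S : uniq (rcons P x ++ S) -> from (rcons P x ++ S) = x :: S.
Proof.
rewrite cat_uniq rcons_uniq => /andP[/andP[xP _] _].
by rewrite /from cat_rcons index_cat (negbTE xP) /= eqxx addn0 drop_size_cat.
Qed.

Lemma index_mid P S : uniq (rcons P x ++ S) -> index x (rcons P x ++ S) = size P.
Proof.
rewrite cat_uniq rcons_uniq => /andP[/andP[xP _] _].
by rewrite cat_rcons index_cat (negbTE xP) /= eqxx addn0.
Qed.

Lemma splitx w : x \in w -> exists P S, w = rcons P x ++ S.
Proof. by case/splitPr => P S; exists P, S; rewrite cat_rcons. Qed.

Definition transfer_moves w :=
  [seq (s, p) | s <- slots dirs (upto w) w, p <- uturns dirs (from w)].
Definition transfer_codes w :=
  [seq (p, s) | p <- uturns dirs (upto w), s <- slots dirs (from w) w].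

(* A detour is inserted before [x] and another one is cut off after [x], so that
   the length is preserved and the position of [x] increases by 2. *)
Definition transfer w (m : ((V * V) * (V * V)) * nat) w'
    (k : nat * ((V * V) * (V * V))) : Prop :=
  exists P S P' S' A x1 y1 B u1 v1 A2 x2 u2 v2 y2 B2,
  [/\ [/\ w = rcons P x ++ S, uniq w, w' = rcons P' x ++ S' & uniq w'],
      rcons P x = A ++ [:: x1, y1 & B] /\ rcons P' x = A ++ [:: x1, u1, v1, y1 & B],
      x :: S = A2 ++ [:: x2, u2, v2, y2 & B2] /\ x :: S' = A2 ++ [:: x2, y2 & B2],
      m = (((x1, y1), (u1, v1)), size A2) & k = (size A, ((x2, y2), (u2, v2)))].

Lemma transfer_inj w1 m1 w2 m2 w' k :
  transfer w1 m1 w' k -> transfer w2 m2 w' k -> w1 = w2 /\ m1 = m2.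
Proof.
move=> [P [S [P' [S' [A [x1 [y1 [B [u1 [v1 [A2 [x2 [u2 [v2 [y2 [B2]]]]]]]]]]]]]]]].
move=> [[-> _ wE un] [PE PE'] [SE SE'] -> ->].
move=> [Q [T [Q' [T' [A3 [x3 [y3 [B3 [u3 [v3 [A4 [x4 [u4 [v4 [y4 [B4]]]]]]]]]]]]]]]].
move=> [[-> _ wE2 _] [QE QE'] [TE TE'] -> [sA e1 e2 e3 e4]].
subst x4 y4 u4 v4.
have [PQ ST] : P' = Q' /\ S' = T'.
  by apply: (@uniq_cut _ x); rewrite -!cat_rcons -wE // wE2.
subst Q' T'.
have AB := PE'; rewrite QE' in AB.
move/eqP: AB; rewrite eqseq_cat // => /andP[/eqP AE /eqP[e1 e2 e3 e4 e5]].
subst A3 x3 u3 v3 y3 B3.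
have uS : uniq (x :: S').
  by move: un; rewrite wE cat_rcons cat_uniq => /and3P[].
have [AE BE] : A2 = A4 /\ y2 :: B2 = y2 :: B4.
  by apply: (@uniq_cut _ x2); rewrite -?SE' // -TE'.
case: BE => BE; subst A4 B4; rewrite -SE in TE; rewrite -PE in QE.
by case: TE => ->; rewrite QE.
Qed.

Lemma transfer_exists w m : saw dirs w -> x \in w -> m \in transfer_moves w ->
  exists w' k, [/\ transfer w m w' k, k \in transfer_codes w' & saw dirs w'].
Proof.
move=> sw /splitx[P [S wE]].
have un : uniq (rcons P x ++ S) by rewrite -wE; case/andP: sw.
rewrite /transfer_moves wE upto_cat // from_cat // -wE.
case/allpairsPdep => [[[x1 y1] [u1 v1]] [p [+ pU ->]]].
rewrite mem_slots => /and5P[/mem_pairs[A [B PE]] xu1 uv1 vy1 /andP[u1w v1w]].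
move: pU; rewrite mem_uturns => /uturnP[A2 [x2 [u2 [v2 [y2 [B2 [SE <- xy2]]]]]]].
have [S' SE'] : exists S', x :: S' = A2 ++ [:: x2, y2 & B2].
  case: A2 SE => [|a A2] [-> _]; first by exists (y2 :: B2).
  by exists (A2 ++ [:: x2, y2 & B2]).
(* [x] may be the endpoint [y1] of the slot; it remains the last vertex in either case. *)
have [P' PE'] : exists P', rcons P' x = A ++ [:: x1, u1, v1, y1 & B].
  case/lastP: B PE => [|B b].
    rewrite -[[:: x1; y1]]/(rcons [:: x1] y1) -rcons_cat => /rcons_inj[_ ->].
    by exists (A ++ [:: x1; u1; v1]); rewrite -cats1 -catA.
  rewrite -!rcons_cons -rcons_cat => /rcons_inj[_ ->].
  by exists (A ++ [:: x1, u1, v1, y1 & B]); rewrite rcons_cat.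
have w2 : w = (P ++ A2) ++ [:: x2, u2, v2, y2 & B2].
  by rewrite wE cat_rcons SE catA.
have sw1 : saw dirs (rcons P x ++ S').
  rewrite cat_rcons SE' catA; apply: (saw_unbump (u := u2) (v := v2)) => //.
  by rewrite -w2.
have w1E : rcons P x ++ S' = A ++ [:: x1, y1 & B ++ S'] by rewrite PE -catA.
have sub t : t \in rcons P x ++ S' -> t \in w.
  rewrite w2 cat_rcons SE' catA mem_cat [in X in _ -> X]mem_cat !inE.
  by case/orP=> [->//|/or3P[] ->]; rewrite !orbT.
have uv1' : u1 != v1.
  by apply: contra dirs0 => /eqP e; move: uv1; rewrite e adjxx.
have sw' : saw dirs (rcons P' x ++ S').
  rewrite PE' -catA; apply: saw_bump => //; rewrite -?w1E //.
    by apply: contra u1w => /sub.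
  by apply: contra v1w => /sub.
have un' : uniq (rcons P' x ++ S') by case/andP: sw'.
exists (rcons P' x ++ S'), (size A, ((x2, y2), (u2, v2))); split => //.
  exists P, S, P', S', A, x1, y1, B, u1, v1, A2, x2, u2, v2, y2, B2.
  by split => //; split => //; rewrite wE.
have srt : sorted adj w by case/andP: sw.
have [x1y1 [xu2 uv2 vy2]] : adj x1 y1 /\ [/\ adj x2 u2, adj u2 v2 & adj v2 y2].
  split; first by move: srt; rewrite wE PE => /cat_sorted2[/cat_sorted2[_ /andP[]]].
  by move: srt; rewrite w2 => /cat_sorted2[_ /= /and4P[]].
rewrite /transfer_codes upto_cat // from_cat //; apply: allpairs_f.
  by rewrite mem_uturns; apply/uturnP; exists A, x1, u1, v1, y1, B.
rewrite mem_slots xu2 uv2 vy2 SE' !andTb.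
have -> : (x2, y2) \in pairs (A2 ++ [:: x2, y2 & B2]).
  by apply/mem_pairs; exists A2, B2.
(* The walk [w'] with the removed vertices [u2], [v2] has the same vertices as [w] with the inserted
   [u1], [v1]. *)
have : uniq ([:: u2; v2] ++ (rcons P' x ++ S')).
  have un2 : uniq ([:: u1; v1] ++ w).
    by rewrite /= inE negb_or uv1' u1w v1w; case/andP: sw.
  rewrite (perm_uniq (s2 := [:: u1; v1] ++ w)) //.
  have -> : w = P ++ A2 ++ [:: x2, u2, v2, y2 & B2] by rewrite w2 catA.
  apply/permP => Q; have := congr1 (count Q) PE'; have := congr1 (count Q) PE.
  have := congr1 (count Q) SE'; have := congr1 (count Q) SE.
  rewrite -!cats1 /= !count_cat /=.
  move: (count Q A) (count Q B) (count Q P) (count Q P') (count Q S') (count Q S).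
  move: (count Q A2) (count Q B2) (nat_of_bool (Q x)).
  move: (nat_of_bool (Q x1)) (nat_of_bool (Q y1)) (nat_of_bool (Q u1)) (nat_of_bool (Q v1)).
  move: (nat_of_bool (Q x2)) (nat_of_bool (Q y2)) (nat_of_bool (Q u2)) (nat_of_bool (Q v2)).
  by clear => *; lia.
by rewrite /= inE negb_or -!andbA => /and4P[_ -> ->].
Qed.

End Transfer.

(** * Change of the counts under a transfer *)

Section Flow.
Variables (V : zmodType) (dirs : seq V).
Hypothesis ud : uniq dirs.
Variable x : V.
Implicit Types (A B Z w P S : seq V).

Definition close_to K (a b : nat) := (a <= b + K)%N && (b <= a + K)%N.

(** 10 for U-turns; for slots, a detour has three edges and two inner vertices. *)
Definition transfer_loss := (10 + slot_loss dirs 3 2)%N.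

Lemma transfer_counts w m w' k : transfer x w m w' k ->
  [/\ close_to transfer_loss (nU dirs (upto x w)) (nU dirs (upto x w')),
      close_to transfer_loss (nU dirs (from x w)) (nU dirs (from x w')),
      close_to transfer_loss (nF dirs (upto x w) w) (nF dirs (upto x w') w') &
      close_to transfer_loss (nF dirs (from x w) w) (nF dirs (from x w') w')].
Proof.
move=> [P [S [P' [S' [A [x1 [y1 [B [u1 [v1 [A2 [x2 [u2 [v2 [y2 [B2]]]]]]]]]]]]]]]].
move=> [[wE un wE' un'] [PE PE'] [SE SE'] _ _].
rewrite wE in un; rewrite wE' in un'.
have loss12 : (slot_loss dirs 1 2 <= transfer_loss)%N.
  apply: leq_trans (leq_addl _ _); rewrite leq_add2r leq_mul2r.
  by rewrite orbT.
have loss32 : (slot_loss dirs 3 2 <= transfer_loss)%N by exact: leq_addl.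
have sub t : t \in w' -> t \in w \/ t \in [:: u1; v1].
  have : {subset rcons P' x <= [:: u1, v1 & rcons P x]}.
    move=> s; rewrite PE PE' !inE !mem_cat !inE.
    by do !case: (_ == _); do !case: (_ \in _); rewrite ?orbT.
  have : {subset S' <= x :: S}.
    move=> s sS; have : s \in x :: S' by rewrite inE sS orbT.
    rewrite SE SE' !mem_cat !inE.
    by do !case: (_ == _); do !case: (_ \in _); rewrite ?orbT.
  move=> h1 h2; rewrite wE wE' !mem_cat => /orP[/h2|/h1].
    by rewrite !inE => /or3P[->|->|->]; rewrite ?orbT; auto.
  by rewrite mem_rcons !inE => /orP[->|->]; rewrite ?orbT; auto.
have sub' t : t \in w -> t \in w' \/ t \in [:: u2; v2].
  have : {subset rcons P x <= rcons P' x}.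
    move=> s; rewrite PE PE' !mem_cat !inE.
    by do !case: (_ == _); do !case: (_ \in _); rewrite ?orbT.
  have : {subset S <= [:: u2, v2 & x :: S']}.
    move=> s sS; have : s \in x :: S by rewrite inE sS orbT.
    rewrite SE SE' !inE !mem_cat !inE.
    by do !case: (_ == _); do !case: (_ \in _); rewrite ?orbT.
  move=> h1 h2; rewrite wE wE' !mem_cat => /orP[/h2 ->|/h1]; first by left.
  by rewrite mem_rcons !inE => /or4P[->|->|->|->]; rewrite ?orbT; auto.
rewrite /close_to wE wE' !upto_cat // !from_cat // -wE -wE'.
have uP : uniq (rcons P x) by move: un; rewrite cat_uniq => /and3P[].
have uP' : uniq (rcons P' x) by move: un'; rewrite cat_uniq => /and3P[].
have uS : uniq (x :: S) by move: un; rewrite cat_rcons cat_uniq => /and3P[].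
have uS' : uniq (x :: S') by move: un'; rewrite cat_rcons cat_uniq => /and3P[].
have [p1 p2] := pairs_bump A x1 u1 v1 y1 B; rewrite -PE -PE' in p1 p2.
have [q1 q2] := pairs_bump A2 x2 u2 v2 y2 B2; rewrite -SE -SE' in q1 q2.
have [n1 n2] := nU_bump dirs A x1 u1 v1 y1 B; rewrite -PE -PE' in n1 n2.
have [r1 r2] := nU_bump dirs A2 x2 u2 v2 y2 B2; rewrite -SE -SE' in r1 r2.
have jn a b c : (c <= 10)%N -> (a <= b + c)%N -> (a <= b + transfer_loss)%N.
  move=> c10 h; apply: leq_trans h _; rewrite leq_add2l.
  by apply: leq_trans c10 _; exact: leq_addr.
split; apply/andP; split.
- exact: jn n2.
- exact: jn n1.
- exact: jn r1.
- exact: jn r2.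
- by apply: leq_trans (nF_le (E := [:: (x1, y1)])
    (X := [:: u1; v1]) ud uP p1 sub) _; rewrite leq_add2l.
- by apply: leq_trans (nF_le (E := [:: (x1, u1); (u1, v1); (v1, y1)])
    (X := [:: u2; v2]) ud uP' p2 sub') _; rewrite leq_add2l.
- by apply: leq_trans (nF_le (E := [:: (x2, u2); (u2, v2); (v2, y2)])
    (X := [:: u1; v1]) ud uS q2 sub) _; rewrite leq_add2l.
- by apply: leq_trans (nF_le (E := [:: (x2, y2)])
    (X := [:: u2; v2]) ud uS' q1 sub') _; rewrite leq_add2l.
Qed.

Lemma transfer_shape w m w' k : transfer x w m w' k ->
  [/\ size w' = size w, x \in w', index x w' = (index x w).+2,
      head (0 : V) w' = head (0 : V) w & last (0 : V) w' = last (0 : V) w].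
Proof.
move=> [P [S [P' [S' [A [x1 [y1 [B [u1 [v1 [A2 [x2 [u2 [v2 [y2 [B2]]]]]]]]]]]]]]]].
move=> [[wE un wE' un'] [PE PE'] [SE SE'] _ _].
have sP : size P' = (size P).+2.
  have := congr1 size PE; have := congr1 size PE'; rewrite !size_rcons !size_cat /=.
  by move: (size P) (size P') (size A) (size B); clear => *; lia.
have sS : size S = (size S').+2.
  have := congr1 size SE; have := congr1 size SE'; rewrite /= !size_cat /=.
  by move: (size S) (size S') (size A2) (size B2); clear => *; lia.
split.
- by rewrite wE wE' !size_cat !size_rcons sP sS !addSn !addnS.
- by rewrite wE' mem_cat mem_rcons inE eqxx.
- by rewrite wE' wE !index_mid -?wE -?wE'.
- by rewrite wE wE' PE PE'; case: (A).
- rewrite wE wE' !last_cat !last_rcons.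
  have := congr1 (last (0 : V)) SE; have := congr1 (last (0 : V)) SE'.
  by rewrite /= !last_cat /= => -> ->.
Qed.

(** Factors of size at most [M * n] that change by [K] change a product by at most
    [2 * K * M * n + K ^+ 2]. The first bound compares codes at the target with moves at the source,
    the second both at the target. *)
Lemma flow_arith (R : realType) (c1 c2 d1 d2 c1' c2' d1' d2' K M n e : R) :
  0 <= K -> 1 <= n -> 0 <= M ->
  0 <= c1' -> 0 <= c2' -> 0 <= d1 -> 0 <= d2 ->
  c1 <= c1' + K -> c2 <= c2' + K -> d1' <= d1 + K -> d2' <= d2 + K ->
  0 <= c1 -> 0 <= c2 -> 0 <= d1' -> 0 <= d2' ->
  c1' <= M * n -> c2' <= M * n -> d1 <= M * n -> d2 <= M * n ->
  d1 * d2 <= c1 * c2 + e ->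
  d1' * d2' <= c1 * c2 + e + (4 * K * M + 2 * K ^+ 2) * n /\
  d1' * d2' <= c1' * c2' + e + (4 * K * M + 2 * K ^+ 2) * n.
Proof.
move=> K0 n1 M0 c1'0 c2'0 d10 d20 hc1 hc2 hd1 hd2 c10 c20 d1'0 d2'0 c1M c2M d1M d2M hcd.
have KK : K ^+ 2 <= K ^+ 2 * n by rewrite ler_peMr // sqr_ge0.
have KM : 0 <= K * M * n by rewrite !mulr_ge0 // (le_trans _ n1).
have e1 : d1' * d2' <= (d1 + K) * (d2 + K) by apply: ler_pM.
have e2 : c1 * c2 <= (c1' + K) * (c2' + K) by apply: ler_pM.
have f1 : K * d1 <= K * (M * n) by rewrite ler_wpM2l.
have f2 : K * d2 <= K * (M * n) by rewrite ler_wpM2l.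
have f3 : K * c1' <= K * (M * n) by rewrite ler_wpM2l.
have f4 : K * c2' <= K * (M * n) by rewrite ler_wpM2l.
have KK0 : 0 <= K ^+ 2 by rewrite sqr_ge0.
split; nra.
Qed.

End Flow.

Section FlowBound.
Variables (V : zmodType) (dirs : seq V).
Hypothesis dirs0 : 0 \notin dirs.
Hypothesis ud : uniq dirs.

(* The number of transfers out of [w] is [nF (upto x w) w * nU (from x w)], the
   number into [w] is [nU (upto x w) * nF (from x w) w]. If the former is at least
   the latter at the start, then after [t] transfers the latter exceeds the former
   by a factor at most [1 + O(t / n)], so over [T <= sqrt n] transfers only a bounded
   factor is lost. The levels are disjoint as a walk visits [x] only once. *)
Lemma flow (R : realType) (eps : R) : 0 < eps ->
  exists (C : R) (n0 : nat), 0 < C /\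
  forall (x : V) (n h T : nat) (ep : V -> V -> bool) (A U : seq (seq V)),
  (n0 <= n)%N -> (T * T <= n)%N -> uniq A -> uniq U ->
  (forall w, saw dirs w -> size w = n.+1 ->
     ep (head (0 : V) w) (last (0 : V) w) -> w \in U) ->
  (forall w, w \in A -> [/\ saw dirs w, size w = n.+1,
     ep (head (0 : V) w) (last (0 : V) w), x \in w & index x w = h]) ->
  (forall w, w \in A -> [/\ eps * n%:R <= (nF dirs (upto x w) w)%:R,
     eps * n%:R <= (nU dirs (from x w))%:R, eps * n%:R <= (nU dirs (upto x w))%:R &
     eps * n%:R <= (nF dirs (from x w) w)%:R]) ->
  (forall w, w \in A -> (nU dirs (upto x w) * nF dirs (from x w) w <=
     nF dirs (upto x w) w * nU dirs (from x w))%N) ->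
  T%:R * (size A)%:R <= C * (size U)%:R.
Proof.
move=> eps0; pose K : R := (transfer_loss dirs)%:R; pose M : R := 2 * ((size dirs ^ 2)%N%:R + 1).
pose L := 4 * K * M + 2 * K ^+ 2.
have K0 : 0 <= K by []; have M0 : 0 <= M by rewrite mulr_ge0 // addr_ge0.
have L0 : 0 <= L.
  have KM : 0 <= K * M by exact: mulr_ge0.
  have KK : 0 <= K ^+ 2 by exact: sqr_ge0.
  by rewrite /L -mulrA addr_ge0 // mulr_ge0.
(* There are at least [(eps * n / 2) ^+ 2] moves, so the imbalance [L * n * T] is at most a fraction
   [c * T / n] of them, and [(1 + c * T / n) ^+ T <= expR c]. *)
pose c := 4 * L / eps ^+ 2.
have e20 : 0 < eps ^+ 2 by rewrite exprn_gt0.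
have c0 : 0 <= c by rewrite divr_ge0 ?(ltW e20) // mulr_ge0.
exists (expR c), (maxn 1 (Num.bound (4 * K ^+ 2 / eps ^+ 2))); split; first exact: expR_gt0.
move=> x n h T ep A U; rewrite geq_max => /andP[n1 n0] TTn uA uU memU baseA cntA ordA.
have nR1 : 1 <= n%:R :> R by rewrite ler1n.
have nR0 : 0 < n%:R :> R by rewrite ltr0n.
have TR : T%:R * T%:R <= n%:R :> R by rewrite -natrM ler_nat.
(* A transfer changes each count by at most [K]; [T] of them leave half of [eps * n]. *)
have KT : K * T%:R <= eps * n%:R / 2.
  have KK : 4 * K ^+ 2 <= eps ^+ 2 * n%:R.
    rewrite [leRHS]mulrC -ler_pdivrMr //; apply: le_trans (_ : (Num.bound (4 * K ^+ 2 / eps ^+ 2))%:R <= _).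
      by apply: ltW; apply: archi_boundP; rewrite divr_ge0 ?(ltW e20) // mulr_ge0 // sqr_ge0.
    by rewrite ler_nat.
  have en0 : 0 <= eps * n%:R / 2 by rewrite divr_ge0 // mulr_ge0 // ltW.
  have KT0 : 0 <= K * T%:R by exact: mulr_ge0.
  have : (K * T%:R) ^+ 2 <= (eps * n%:R / 2) ^+ 2.
    have : K ^+ 2 * T%:R ^+ 2 <= K ^+ 2 * n%:R.
      by rewrite ler_wpM2l ?expr2 // mulr_ge0.
    have : 4 * K ^+ 2 * n%:R <= eps ^+ 2 * n%:R * n%:R by rewrite ler_wpM2r // ltW.
    lra.
  by rewrite ler_sqr.
pose c1 w := nF dirs (upto x w) w; pose c2 w := nU dirs (from x w).
pose d1 w := nU dirs (upto x w); pose d2 w := nF dirs (from x w) w.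
pose Inv t w := [/\ saw dirs w, size w = n.+1,
  ep (head (0 : V) w) (last (0 : V) w), x \in w /\ index x w = (h + 2 * t)%N &
  [/\ eps * n%:R <= (c1 w)%:R + K * t%:R, eps * n%:R <= (c2 w)%:R + K * t%:R,
      eps * n%:R <= (d1 w)%:R + K * t%:R, eps * n%:R <= (d2 w)%:R + K * t%:R &
      (d1 w)%:R * (d2 w)%:R <= (c1 w)%:R * (c2 w)%:R + L * n%:R * t%:R]].
have ubF Z w : (size Z <= n.+1)%N -> (nF dirs Z w)%:R <= M * n%:R.
  move=> sZ; apply: le_trans (_ : (n.+1 * size dirs ^ 2)%N%:R <= _).
    by rewrite ler_nat; apply: leq_trans (nF_size _ _ _) _; rewrite leq_mul2r sZ orbT.
  rewrite natrM /M -natr1.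
  have : 0 <= (size dirs ^ 2)%N%:R :> R by [].
  nra.
have ubU Z : (size Z <= n.+1)%N -> (nU dirs Z)%:R <= M * n%:R.
  move=> sZ; apply: le_trans (_ : n.+1%:R <= _).
    by rewrite ler_nat; apply: leq_trans (nU_size _ _) _.
  rewrite /M -natr1.
  have : 0 <= (size dirs ^ 2)%N%:R :> R by [].
  nra.
have sub_up w : size w = n.+1 -> (size (upto x w) <= n.+1)%N.
  by move=> <-; rewrite -{2}(cat_take_drop (index x w).+1 w) size_cat leq_addr.
have sub_from w : size w = n.+1 -> (size (from x w) <= n.+1)%N.
  by move=> <-; rewrite -{2}(cat_take_drop (index x w) w) size_cat leq_addl.
have half t w : (t < T)%N -> Inv t w -> [/\ eps * n%:R / 2 <= (c1 w)%:R,
    eps * n%:R / 2 <= (c2 w)%:R, 0 <= (d1 w)%:R :> R & 0 <= (d2 w)%:R :> R].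
  move=> tT [_ _ _ _ [h1 h2 _ _ _]].
  have : K * t%:R <= K * T%:R by rewrite ler_wpM2l // ler_nat ltnW.
  by split => //; lra.
have en0 : 0 < eps * n%:R / 2 by rewrite divr_gt0 // mulr_gt0.
pose step w m w' k := transfer x w m w' k /\ saw dirs w'.
have gap w m w' k : transfer x w m w' k ->
    [/\ [/\ (c1 w)%:R <= (c1 w')%:R + K, (c2 w)%:R <= (c2 w')%:R + K,
        (d1 w')%:R <= (d1 w)%:R + K & (d2 w')%:R <= (d2 w)%:R + K],
      (d1 w)%:R <= (d1 w')%:R + K & (d2 w)%:R <= (d2 w')%:R + K].
  move=> /(transfer_counts ud)[/andP[a1 a2] /andP[a3 a4] /andP[a5 a6] /andP[a7 a8]].
  by rewrite /K -!natrD !ler_nat.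
have arith t w m w' k : Inv t w -> transfer x w m w' k ->
    (d1 w')%:R * (d2 w')%:R <= (c1 w)%:R * (c2 w)%:R + L * n%:R * t%:R + L * n%:R /\
    (d1 w')%:R * (d2 w')%:R <= (c1 w')%:R * (c2 w')%:R + L * n%:R * t%:R + L * n%:R.
  move=> [_ sw _ _ [_ _ _ _ hcd]] st.
  have [[g1 g2 g3 g4] _ _] := gap _ _ _ _ st.
  have [sw' _ _ _ _] := transfer_shape st; rewrite sw in sw'.
  apply: (flow_arith K0 nR1 M0 _ _ _ _ g1 g2 g3 g4) => //.
  - by apply: ubF; exact: sub_up.
  - by apply: ubU; exact: sub_from.
  - by apply: ubU; exact: sub_up.
  - by apply: ubF; exact: sub_from.
have Inv_step t w m w' k : (t < T)%N -> Inv t w -> m \in transfer_moves dirs x w ->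
    step w m w' k -> Inv t.+1 w'.
  move=> tT Iw _ [st sw'].
  have [sz' xw' ix' hd' lt'] := transfer_shape st.
  have [[g1 g2 g3 g4] g5 g6] := gap _ _ _ _ st.
  have [_ a2] := arith _ _ _ _ _ Iw st.
  have [sw szw epw [xw ixw] [h1 h2 h3 h4 h5]] := Iw.
  have e1 : K * t.+1%:R = K * t%:R + K by rewrite -natr1; ring.
  have e2 : L * n%:R * t.+1%:R = L * n%:R * t%:R + L * n%:R by rewrite -natr1; ring.
  split; rewrite ?hd' ?lt' //; first by rewrite sz'.
    by split=> //; rewrite ix' ixw mulnS add2n !addnS.
  by rewrite e1 e2; move: a2 h1 h2 h3 h4 g1 g2 g3 g4 g5 g6; clear; split; lra.
pose lam : R := 1 + c * T%:R / n%:R.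
have cT0 : 0 <= c * T%:R / n%:R by rewrite divr_ge0 ?(ltW nR0) // mulr_ge0.
have lam1 : 1 <= lam by rewrite /lam lerDl.
have lamT : lam ^+ T <= expR c.
  apply: le_trans (_ : expR (c * T%:R / n%:R) ^+ T <= _).
    rewrite lerXn2r ?nnegrE ?expR_ge0 // ?(le_trans _ lam1) //.
    exact: expR_ge1Dx.
  rewrite -expRM_natl ler_expR mulrA ler_pdivrMr // mulrCA ler_wpM2l //.
have ratio t w m w' k : (t < T)%N -> Inv t w -> transfer x w m w' k ->
    (size (transfer_codes dirs x w'))%:R <= lam * (size (transfer_moves dirs x w))%:R.
  move=> tT Iw st; rewrite !size_allpairs -!/(nU _ _) -!/(nF _ _ _) !natrM.
  rewrite -/(c1 w) -/(c2 w) -/(d1 w') -/(d2 w').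
  have [a1 _] := arith _ _ _ _ _ Iw st.
  have [h1 h2 _ _] := half _ _ tT Iw.
  apply: le_trans a1 _.
  have tT' : t%:R + 1 <= T%:R :> R by rewrite natr1 ler_nat.
  have b1 : L * n%:R * t%:R + L * n%:R <= L * n%:R * T%:R.
    rewrite -[X in _ + X]mulr1 -mulrDr ler_wpM2l // mulr_ge0 // ltW //.
  have b2 : (eps * n%:R / 2) * (eps * n%:R / 2) <= (c1 w)%:R * (c2 w)%:R.
    by apply: ler_pM => //; exact: ltW.
  have b3 : L * n%:R * T%:R = c * T%:R / n%:R * (eps * n%:R / 2 * (eps * n%:R / 2)).
    by rewrite /c; field; rewrite ?gt_eqF.
  have b4 : c * T%:R / n%:R * (eps * n%:R / 2 * (eps * n%:R / 2)) <=
      c * T%:R / n%:R * ((c1 w)%:R * (c2 w)%:R) by rewrite ler_wpM2l.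
  rewrite /lam; lra.
have AInv w : w \in A -> Inv 0 w.
  move=> wA; have [h1 h2 h3 h4 h5] := baseA _ wA; have [k1 k2 k3 k4] := cntA _ wA.
  split => //; first by rewrite h5 muln0 addn0.
  by rewrite !mulr0 !addr0 -!natrM ler_nat; split => //; exact: ordA.
have level t : (t <= T)%N -> (size A)%:R <= expR c *
    (count (fun w => index x w == h + 2 * t)%N U)%:R.
  move=> tT.
  have [|||||B [uB AB BInv]] := @double_count_iter R _ _ _ (transfer_moves dirs x)
    (transfer_codes dirs x) step Inv lam T _ _ _ Inv_step _ _ A uA AInv t tT.
  - move=> s w sT [/andP[uw _] _ _ _ _]; apply: allpairs_uniq.
    + by apply: uniq_slots => //; exact: take_uniq.
    + exact: uniq_uturns.
    + by move=> [? ?] [? ?] _ _ [-> ->].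
  - move=> s w sT Iw; have [h1 h2 _ _] := half _ _ sT Iw.
    rewrite -size_eq0 size_allpairs muln_eq0 negb_or -!lt0n -!(ltr0n R).
    by apply/andP; split; apply: lt_le_trans en0 _.
  - move=> s w m sT Iw mw; have [sw _ _ [xw _] _] := Iw.
    have [w' [k [st kc sw']]] := transfer_exists dirs0 sw xw mw.
    by exists w', k; split => //; exact: ratio sT Iw st.
  - move=> w1 m1 w2 m2 w' k [s1 _] [s2 _]; exact: transfer_inj s1 s2.
  - exact: le_trans lam1.
  apply: le_trans AB _; apply: ler_pM => //.
  - by rewrite exprn_ge0 // (le_trans _ lam1).
  - by apply: le_trans lamT; apply: ler_weXn2l.
  rewrite ler_nat -size_filter; apply: uniq_leq_size => // w /BInv[sw sz epw [_ ix] _].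
  by rewrite mem_filter ix eqxx memU.
have -> : T%:R * (size A)%:R = \sum_(t < T) (size A)%:R :> R.
  by rewrite big_const_ord iter_addr_0 mulr_natl.
apply: le_trans (_ : \sum_(t < T) expR c *
    (count (fun w => index x w == h + 2 * t)%N U)%:R <= _).
  by apply: ler_sum => t _; apply: level; exact: ltnW.
rewrite -mulr_sumr -natr_sum ler_pM2l ?expR_gt0 // ler_nat.
under eq_bigr do rewrite -sum1_count big_mkcond.
rewrite exchange_big /= -sum1_size; apply: leq_sum => w _.
case: (pickP (fun t : 'I_T => index x w == h + 2 * t)%N) => [t0 t0P|no].
  rewrite (bigD1 t0) //= t0P big1 // => t tt0; case: eqP => // e.
  case/eqP: tt0; apply: val_inj => /=; move/eqP: t0P; rewrite e.
  by clear; lia.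
by rewrite big1 // => t _; rewrite no.
Qed.

End FlowBound.

(** * The midpoint *)

Lemma leq_count_in (T : eqType) (P Q : pred T) (s : seq T) :
  (forall t, t \in s -> P t -> Q t) -> (count P s <= count Q s)%N.
Proof.
move=> PQ; rewrite -(@eq_in_count _ (predI P Q) P s); last first.
  by move=> t ts /=; case: (boolP (P t)) => // /(PQ _ ts) ->.
by apply: sub_count => t /andP[].
Qed.

Section Midpoint.
Variables (R : realType) (V : zmodType) (dirs : seq V).
Hypothesis dirsN : forall a, a \in dirs -> - a \in dirs.
Hypothesis dirs0 : 0 \notin dirs.
Hypothesis ud : uniq dirs.
Hypothesis rungs_ex : forall a, a \in dirs -> exists b, (a, b) \in ladder_dirs dirs.
Hypothesis cn_gt0 : forall n, (0 < cn dirs n)%N.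
Implicit Types (w : seq V).

Lemma count_cut (m n : nat) (P Q : pred (seq V)) :
  (count (fun w => P (take m.+1 w) && Q (shift (drop m w))) (saws dirs (m + n)) <=
   count P (saws dirs m) * count Q (saws dirs n))%N.
Proof.
have cE (T : pred (seq V)) s : (count T s)%:R = \sum_(w <- s) (T w)%:R :> R.
  have -> : count T s = (\sum_(w <- s) T w)%N.
    by rewrite -sum1_count big_mkcond; apply: eq_bigr => w _; case: (T w).
  by rewrite natr_sum.
rewrite -(ler_nat R) natrM !cE.
apply: le_trans (sum_cut m n (f := fun w => (P w)%:R) (g := fun w => (Q w)%:R) ud _ _) => //.
by apply: ler_sum => w _; rewrite -natrM mulnb.
Qed.

Section Mu.
Variable mu : R.
Hypothesis mu1 : 1 <= mu.
Hypothesis up : forall theta, mu < theta ->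
  exists2 C, 0 < C & forall n, (cn dirs n)%:R <= C * theta ^+ n.

Lemma half_small (F : nat -> pred (seq V)) : exp_small dirs mu F ->
  exists C rho m0, [/\ 0 < C, 0 < rho < mu & forall m k, (m0 <= m)%N -> (k <= m.+1)%N ->
    (count (F m) (saws dirs m) * cn dirs k)%N%:R <= C * rho ^+ (m + k)].
Proof.
move=> [C1 [r1 [m0 [C10 /andP[r10 r1m] H]]]].
have mu0 : 0 < mu by apply: lt_le_trans mu1.
have rmu : r1 / mu < 1 by rewrite ltr_pdivrMr // mul1r.
(* The power 4 pays for the rate [mu / q] on the other half and for the final rate [mu * q], since
   [m + 2 * k <= 4 * m + 2]. *)
have [q /andP[q0 q1] q4] := near_one_root 4 rmu.
have mut : mu < mu / q by rewrite ltr_pdivlMr // gtr_pMr.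
have [C C0 leC] := up mut.
exists (C1 * C / q ^+ 2), (mu * q), (maxn m0 1); split.
- by rewrite divr_gt0 ?mulr_gt0 ?exprn_gt0.
- by rewrite mulr_gt0 //= gtr_pMr.
move=> m k; rewrite geq_max => /andP[m0m m1] km; rewrite natrM.
have r1q : r1 <= q ^+ 4 * mu by rewrite -ler_pdivrMr.
have e1 : (count (F m) (saws dirs m))%:R <= C1 * (q ^+ 4 * mu) ^+ m.
  apply: le_trans (H _ m0m) _; rewrite ler_pM2l //.
  by apply: lerXn2r; rewrite // nnegrE ?(ltW r10) // mulr_ge0 ?exprn_ge0 ?(ltW q0) ?(ltW mu0).
apply: le_trans (ler_pM _ _ e1 (leC k)) _ => //.
have split1 z : C1 * (z * mu) ^+ m * (C * (mu / q) ^+ k) =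
    C1 * C * mu ^+ (m + k) * (z ^+ m / q ^+ k).
  by rewrite !exprMn exprD exprVn; ring.
have split2 : C1 * C / q ^+ 2 * (mu * q) ^+ (m + k) =
    C1 * C * mu ^+ (m + k) * (q ^+ (m + k) / q ^+ 2).
  by rewrite [(mu * q) ^+ _]exprMn; ring.
rewrite split1 split2 -exprM.
rewrite ler_wpM2l ?mulr_ge0 ?exprn_ge0 ?(ltW C0) ?(ltW C10) ?(ltW mu0) //.
rewrite ler_pdivrMr ?exprn_gt0 // mulrAC ler_pdivlMr ?exprn_gt0 // -!exprD.
apply: ler_wiXn2l; rewrite ?(ltW q0) ?(ltW q1) //.
by move: km; clear; lia.
Qed.

Lemma few_uturns_halves : exists eps : R, [/\ 0 < eps,
  exp_small dirs mu (fun n w =>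
    (nU dirs (middle 0 (n - n./2) w))%:R < eps * n%:R) &
  exp_small dirs mu (fun n w => (nU dirs (middle n./2 0 w))%:R < eps * n%:R)].
Proof.
have [eps e0 H] := few_uturns_rare dirsN ud rungs_ex mu1 up.
have [C [rho [m0 [C0 rho0 Hm]]]] := half_small H.
(* Each half has at least [n / 3] steps once [n >= 3]. *)
exists (eps / 3); split; first by rewrite divr_gt0.
- exists C, rho, (2 * m0 + 3)%N; split => // n nm.
  have half_n : (n <= 3 * n./2)%N by move: nm; clear; lia.
  have hn : (n./2 + (n - n./2) = n)%N by clear; lia.
  rewrite -[in leRHS]hn; apply: le_trans (Hm n./2 (n - n./2)%N _ _); last 2 first.
  + by move: nm; clear; lia.
  + by clear; lia.
  rewrite ler_nat.
  have := count_cut n./2 (n - n./2) (fun w => (nU dirs w)%:R < eps * (n./2)%:R) predT.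
  rewrite count_predT hn; apply: leq_trans; apply: leq_count_in => w.
  rewrite mem_saws => /and3P[/eqP sw _ _] lt; rewrite andbT.
  have -> : take (n./2).+1 w = middle 0 (n - n./2) w.
    by rewrite /middle drop0 sw subn0 subSn ?leq_subr // subKn //; clear; lia.
  apply: lt_le_trans lt _; rewrite -mulrA ler_pM2l //.
  by rewrite ler_pdivrMl // -natrM ler_nat.
exists C, rho, (2 * m0 + 3)%N; split => // n nm.
have hn : (n./2 + (n - n./2) = n)%N by clear; lia.
rewrite -[in leRHS]hn addnC; apply: le_trans (Hm (n - n./2)%N n./2 _ _); last 2 first.
+ by move: nm; clear; lia.
+ by clear; lia.
rewrite ler_nat mulnC.
have := count_cut n./2 (n - n./2) predT (fun w => (nU dirs w)%:R < eps * (n - n./2)%N%:R).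
rewrite count_predT hn; apply: leq_trans; apply: leq_count_in => w.
rewrite mem_saws => /and3P[/eqP sw _ _] lt; rewrite andTb nU_shift.
have -> : drop n./2 w = middle n./2 0 w.
  by rewrite /middle subn0 -size_drop take_size.
apply: lt_le_trans lt _; rewrite -mulrA ler_pM2l //.
by rewrite ler_pdivrMl // -natrM ler_nat; clear; lia.
Qed.

Lemma typical_counts : exists eps : R, 0 < eps /\
  exp_small dirs mu (fun n w => ~~
   [&& eps * n%:R <= (nF dirs (take (n./2).+1 w) w)%:R,
     eps * n%:R <= (nU dirs (drop n./2 w))%:R,
     eps * n%:R <= (nU dirs (take (n./2).+1 w))%:R &
     eps * n%:R <= (nF dirs (drop n./2 w) w)%:R]).
Proof.
have [e1 [e10 U1 U2]] := few_uturns_halves.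
have [e2 [e20 H2]] := few_slots_rare ud mu1 up e10.
have F1 := H2 (fun=> 0%N) (fun n => n - n./2)%N.
have F2 := H2 (fun n => n./2) (fun=> 0%N).
exists (Num.min e1 e2); split; first by rewrite lt_min e10.
have U12 := exp_smallU (n1 := 0) U1 U2 (fun n w _ _ h => h).
have F12 := exp_smallU (n1 := 0) F1 F2 (fun n w _ _ h => h).
apply: (exp_smallU (n1 := 0) U12 F12) => n w _.
rewrite mem_saws => /and3P[/eqP sw _ _].
have mE1 : middle 0 (n - n./2) w = take (n./2).+1 w.
  by rewrite /middle drop0 sw subn0 subSn ?leq_subr // subKn //; clear; lia.
have mE2 : middle n./2 0 w = drop n./2 w.
  by rewrite /middle subn0 -size_drop take_size.
rewrite mE1 mE2.
have n0 : 0 <= n%:R :> R by [].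
have m1 : Num.min e1 e2 * n%:R <= e1 * n%:R by rewrite ler_wpM2r // ge_min lexx.
have m2 : Num.min e1 e2 * n%:R <= e2 * n%:R by rewrite ler_wpM2r // ge_min lexx orbT.
apply: contraR; rewrite !negb_or !negb_and -!leNgt -!ltNge.
move=> /andP[/andP[a1 a2] /andP[b1 b2]].
case/orP: b1 => b1; last by move: (lt_le_trans b1 a1); rewrite ltxx.
case/orP: b2 => b2; last by move: (lt_le_trans b2 a2); rewrite ltxx.
by apply/and4P; split;
  [exact: le_trans m2 b1 | exact: le_trans m1 a2 | exact: le_trans m1 a1 | exact: le_trans m2 b2].
Qed.

End Mu.

(* Walks with more transfers into them than out of them are reversed. *)
Lemma midpoint_bound : exists (C : R) (n0 : nat), 0 < C /\
  forall n T, (n0 <= n)%N -> (T * T <= n)%N -> forall x,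
  T%:R * (count (fun w => nth (0 : V) w n./2 == x) (saws dirs n))%:R <=
    C * (cn dirs n)%:R.
Proof.
have [mu [mu1 mu_le up]] := @connective_constant R (cn dirs) cn_gt0 (fun m n => cn_cut R m n ud).
have mu0 : 0 < mu by apply: lt_le_trans mu1.
have [eps [e0 [Cb [rho [nb [Cb0 /andP[rho0 rhom] bad]]]]]] := typical_counts mu1 up.
have [C [nf [C0 flowP]]] := flow dirs0 ud e0.
(* Atypical walks must stay negligible after multiplication by [T <= n]: Bernoulli's inequality for
   [(1 + t) ^+ n] gives [n * rho ^+ n <= mu ^+ n / t]. *)
pose t := mu / rho - 1.
have t0 : 0 < t by rewrite subr_gt0 ltr_pdivlMr // mul1r.
exists (Cb / t + (C + C)), (maxn nb nf); split.
  by rewrite !addr_gt0 // divr_gt0.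
move=> n T; rewrite geq_max => /andP[nbn nfn] TT x.
have Tn : (T <= n)%N by move: TT; clear; case: T => // T; nia.
set h := n./2.
have hn : (h <= n)%N by rewrite /h; clear; lia.
pose good w := [&& eps * n%:R <= (nF dirs (take h.+1 w) w)%:R,
  eps * n%:R <= (nU dirs (drop h w))%:R, eps * n%:R <= (nU dirs (take h.+1 w))%:R &
  eps * n%:R <= (nF dirs (drop h w) w)%:R].
pose ord w := (nU dirs (take h.+1 w) * nF dirs (drop h w) w <=
   nF dirs (take h.+1 w) w * nU dirs (drop h w))%N.
pose A1 := [seq w <- saws dirs n | [&& nth (0 : V) w h == x, good w & ord w]].
pose A2 := [seq w <- saws dirs n | [&& nth (0 : V) w h == x, good w & ~~ ord w]].
have splitX : (count (fun w => nth (0%R : V) w h == x) (saws dirs n) <=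
    count (predC good) (saws dirs n) + (size A1 + size A2))%N.
  rewrite !size_filter; elim: (saws dirs n) => //= w s.
  move: (count _ s) (count _ s) (count _ s) (count _ s).
  by case: (_ == x); case: (good w); case: (ord w); clear => /= *; lia.
have badT : T%:R * (count (predC good) (saws dirs n))%:R <= Cb / t * (cn dirs n)%:R.
  apply: le_trans (_ : n%:R * (Cb * rho ^+ n) <= _).
    by apply: ler_pM; rewrite ?ler_nat //; exact: bad.
  have B := bernoulli_up n (ltW t0).
  have rn0 : 0 < rho ^+ n by rewrite exprn_gt0.
  have e1 : 1 + t = mu / rho by rewrite /t addrCA subrr addr0.
  rewrite e1 expr_div_n ler_pdivlMr // in B.
  have B2 : n%:R * rho ^+ n <= (cn dirs n)%:R / t.
    rewrite ler_pdivlMr //; apply: le_trans (mu_le n); apply: le_trans B.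
    have := ltW rn0; lra.
  rewrite mulrCA -mulrA [t^-1 * _]mulrC ler_pM2l //.
have X w : w \in saws dirs n -> nth (0 : V) w h == x ->
    [/\ size w = n.+1, saw dirs w, x \in w & index x w = h].
  rewrite mem_saws => /and3P[/eqP sw _ sww] /eqP <-.
  have hw : (h < size w)%N by rewrite sw.
  by split => //; [exact: mem_nth | rewrite index_uniq //; case/andP: sww].
have A1P : T%:R * (size A1)%:R <= C * (cn dirs n)%:R.
  (* Transfers fix both ends. The walks here start at 0; the reversed ones below end at 0. *)
  apply: (flowP x n h T (fun a _ => a == 0) A1 (saws dirs n)) => //.
  - by rewrite filter_uniq // uniq_saws.
  - exact: uniq_saws.
  - by move=> w sw szw hw; rewrite mem_saws szw hw sw eqxx.
  - move=> w; rewrite mem_filter => /andP[/and3P[wx _ _] ws].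
    have [s1 s2 s3 s4] := X _ ws wx; split => //.
    by move: ws; rewrite mem_saws => /and3P[].
  - move=> w; rewrite mem_filter => /andP[/and3P[wx gw _] ws].
    have [s1 s2 s3 s4] := X _ ws wx; rewrite /upto /from s4.
    by case/and4P: gw.
  - move=> w; rewrite mem_filter => /andP[/and3P[wx _ ow] ws].
    by have [s1 s2 s3 s4] := X _ ws wx; rewrite /upto /from s4.
have A2P : T%:R * (size A2)%:R <= C * (cn dirs n)%:R.
  (* Reversal exchanges the two halves, so the failure of [ord] becomes the order that [flowP] asks
     for. The time of [x] becomes [n - h], which differs from [h] for odd [n]. *)
  have revP w : w \in saws dirs n -> nth (0 : V) w h == x ->
      [/\ index x (rev w) = (n - h)%N, upto x (rev w) = rev (drop h w) &
          from x (rev w) = rev (take h.+1 w)].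
    move=> ws wx; have [s1 s2 s3 s4] := X _ ws wx.
    have ix : index x (rev w) = (n - h)%N.
      have nx : nth (0 : V) (rev w) (n - h) = x.
        rewrite nth_rev s1 ?ltnS ?leq_subr // subSS subKn //; exact/eqP.
      rewrite -{1}nx index_uniq ?size_rev ?s1 ?ltnS ?leq_subr //.
      by rewrite rev_uniq; case/andP: s2.
    rewrite /upto /from ix; split => //.
      by rewrite take_rev s1 subSS subKn.
    by rewrite drop_rev s1 subSn ?leq_subr // subKn.
  have uw w : w \in saws dirs n -> uniq w.
    by rewrite mem_saws => /and3P[_ _ /andP[]].
  rewrite -(size_map rev A2) /cn -(size_map rev (saws dirs n)).
  have revI := can_inj (@revK V).
  have eqi w : w =i rev w by move=> v; rewrite mem_rev.
  apply: (flowP x n (n - h)%N T (fun _ b => b == 0)) => //.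
  - by rewrite map_inj_uniq // filter_uniq // uniq_saws.
  - by rewrite map_inj_uniq // uniq_saws.
  - move=> w sw szw hw; apply/mapP; exists (rev w); last by rewrite revK.
    rewrite mem_saws size_rev szw eqxx saw_rev // sw andbT.
    by move: hw szw; case/lastP: (w) => // w' v; rewrite last_rcons rev_rcons.
  - move=> _ /mapP[w + ->]; rewrite mem_filter => /andP[/and3P[wx _ _] ws].
    have [s1 s2 s3 s4] := X _ ws wx; have [r1 _ _] := revP _ ws wx.
    rewrite saw_rev // size_rev mem_rev; split => //.
    move: ws; rewrite mem_saws => /and3P[_ + _].
    by case: (w) s3 => // v w' _; rewrite rev_cons last_rcons.
  - move=> _ /mapP[w + ->]; rewrite mem_filter => /andP[/and3P[wx gw _] ws].
    have [_ -> ->] := revP _ ws wx; have sym := adj_sym dirsN.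
    rewrite !nU_rev // !(nF_rev (w := w)) ?take_uniq ?drop_uniq ?(uw w ws) //.
    by case/and4P: gw.
  - move=> _ /mapP[w + ->]; rewrite mem_filter => /andP[/and3P[wx _ ow] ws].
    have [_ -> ->] := revP _ ws wx; have sym := adj_sym dirsN.
    rewrite !nU_rev // !(nF_rev (w := w)) ?take_uniq ?drop_uniq ?(uw w ws) //.
    by move: ow; rewrite /ord -ltnNge mulnC [leqRHS]mulnC => /ltnW.
rewrite !mulrDl; apply: le_trans (lerD badT (lerD A1P A2P)).
by rewrite -!mulrDr ler_wpM2l // -!natrD ler_nat.
Qed.

End Midpoint.

(** * The cubic lattice *)

Section UnitVectors.
Variable d : nat.
Local Notation V := 'rV[int]_d.

(** The coordinates of a unit vector are -1, 0 or 1, hence the finite functions to ['I_3]. *)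
Definition unit_vectors : seq V :=
  [seq v : V <- undup [seq \row_j ((f j : nat)%:Z - 1) | f : {ffun 'I_d -> 'I_3}] |
    \sum_j `|v 0 j| == 1].

Lemma mem_unit_vectors (v : V) : (v \in unit_vectors) = (\sum_j `|v 0 j| == 1).
Proof.
rewrite mem_filter mem_undup; case: eqP => //= v1.
apply/mapP; exists [ffun j => inord (absz (v 0 j + 1))]; first by rewrite mem_enum.
apply/rowP => j; rewrite mxE ffunE.
have : `|v 0 j| <= 1 by rewrite -v1 (bigD1 j) //= lerDl sumr_ge0.
by rewrite ler_norml => /andP[]; move: (v 0 j); clear => z; move=> *; rewrite inordK; lia.
Qed.

Lemma uniq_unit_vectors : uniq unit_vectors.
Proof. exact/filter_uniq/undup_uniq. Qed.

Lemma unit_vectorsN a : a \in unit_vectors -> - a \in unit_vectors.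
Proof.
rewrite !mem_unit_vectors => /eqP <-; apply/eqP.
by apply: eq_bigr => j _; rewrite mxE normrN.
Qed.

Lemma unit_vectors0 : 0 \notin unit_vectors.
Proof. by rewrite mem_unit_vectors big1 // => j _; rewrite mxE normr0. Qed.

Lemma unit_vectors_rungs : (2 <= d)%N -> forall a, a \in unit_vectors ->
  exists b, (a, b) \in ladder_dirs unit_vectors.
Proof.
move=> d2 a aU; have := aU; rewrite mem_unit_vectors => /eqP a1.
have [i ai] : exists i, a 0 i != 0.
  apply/existsP; apply: contra_eqT a1; rewrite negb_exists => /forallP a0.
  by rewrite big1 // => j _; move: (a0 j); rewrite negbK => /eqP ->; rewrite normr0.
have rest0 : `|a 0 i| = 1 /\ forall j, j != i -> a 0 j = 0.
  have : 0 <= \sum_(j | j != i) `|a 0 j| by apply: sumr_ge0.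
  move: a1; rewrite (bigD1 i) //= => a1 s0.
  have s00 : \sum_(j | j != i) `|a 0 j| = 0.
    by move: a1 s0 ai; move: (\sum_(j | _) _) (a 0 i); clear => *; lia.
  split; first by rewrite s00 addr0 in a1.
  move=> j ji; apply/normr0_eq0; move/eqP: s00; rewrite psumr_eq0 // => /allP/(_ j).
  by rewrite mem_index_enum ji => /(_ isT) /eqP.
have [ai1 aj] := rest0.
have [j ji] : exists j : 'I_d, j != i.
  case: (eqVneq i (Ordinal (ltnW d2))) => [->|i0].
    by exists (Ordinal d2).
  by exists (Ordinal (ltnW d2)); rewrite eq_sym.
pose b : V := delta_mx 0 j.
have bj : b 0 j = 1 by rewrite mxE !eqxx.
have bi : b 0 i = 0 by rewrite mxE eqxx eq_sym (negbTE ji).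
have bU : b \in unit_vectors.
  rewrite mem_unit_vectors (bigD1 j) //= bj big1 ?addr0 //.
  by move=> k kj; rewrite mxE (negbTE kj) andbF normr0.
clearbody b; exists b; rewrite mem_filter allpairs_f // andbT.
(* The six vertices already differ in the coordinates [i] and [j]. *)
apply: (@map_uniq _ _ (fun v : V => (v 0 i, v 0 j))).
rewrite /= !mxE bj bi (aj _ ji).
have [->|->] : a 0 i = 1 \/ a 0 i = -1 by move: ai1; clear; lia.
  by [].
by [].
Qed.

End UnitVectors.

(** * From lists of vertices to walks as finite functions *)

Section Translation.
Variables (R : realType) (d : nat).
Hypothesis d2 : (2 <= d)%N.
Local Notation V := 'rV[int]_d.
Local Notation dirs := (unit_vectors d).

Definition walk_ffun n (w : seq V) : {ffun 'I_n.+1 -> V} :=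
  [ffun i : 'I_n.+1 => nth (0 : V) w i].

Lemma walk_ffun_inord n w k : (k <= n)%N -> walk_ffun n w (inord k) = nth (0 : V) w k.
Proof. by move=> kn; rewrite ffunE inordK. Qed.

Lemma walk_ffun_inj n : {in [pred w : seq V | size w == n.+1] &, injective (walk_ffun n)}.
Proof.
move=> w1 w2; rewrite !inE => /eqP s1 /eqP s2 e.
apply: (@eq_from_nth _ (0 : V)); rewrite s1 ?s2 // => k kn.
by rewrite -!(@walk_ffun_inord n) // e.
Qed.

Lemma adj_nearest (x y : V) : adj dirs x y <-> nearest_neighbours x y.
Proof.
rewrite /adj mem_unit_vectors /nearest_neighbours.
rewrite (eq_bigr (fun j => `|x 0 j - y 0 j|)); first by split=> [/eqP|->].
by move=> j _; rewrite !mxE distrC.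
Qed.

Lemma walk_ffun_SAW n (w : seq V) : w \in saws dirs n -> SAW d n (walk_ffun n w).
Proof.
rewrite mem_saws => /and3P[/eqP sw hw /andP[uw srt]]; split.
- move=> i ilt; rewrite (walk_ffun_inord w (ltnW ilt)) (walk_ffun_inord w ilt).
  apply/adj_nearest.
  by have /(sortedP (0 : V)) := srt; apply; rewrite sw ltnS.
- move=> i j; rewrite !ffunE => /eqP; rewrite nth_uniq ?sw // => /eqP.
  exact: val_inj.
- by rewrite ffunE /= nth0; exact/eqP.
Qed.

Lemma SAW_walk_ffun n (g : {ffun 'I_n.+1 -> V}) : SAW d n g ->
  exists2 w, w \in saws dirs n & g = walk_ffun n w.
Proof.
move=> [gw ginj g0]; pose w := mkseq (fun k => g (inord k)) n.+1.
have gE : g = walk_ffun n w.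
  by apply/ffunP => i; rewrite ffunE nth_mkseq // inord_val.
have i0 : inord 0 = ord0 :> 'I_n.+1 by apply: val_inj; rewrite /= inordK.
have hw : head (0 : V) w = 0 by rewrite -nth0 nth_mkseq // i0.
exists w => //; rewrite mem_saws size_mkseq eqxx hw eqxx !andTb; apply/andP; split.
  apply/mkseq_uniqP => i j; rewrite !inE => il jl /ginj /(congr1 val) /=.
  by rewrite !inordK.
apply/(sortedP (0 : V)) => i; rewrite size_mkseq ltnS => il.
have e k : (k <= n)%N -> nth (0 : V) w k = g (inord k).
  by move=> kn; rewrite nth_mkseq.
by rewrite (e _ (ltnW il)) (e _ il); apply/adj_nearest/gw.
Qed.

Lemma card_SAW n (P : pred V) (k : nat) : (k <= n)%N ->
  #|` fset_set (SAW d n `&` [set g | P (g (inord k))])%classic| =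
  count (fun w => P (nth (0 : V) w k)) (saws dirs n).
Proof.
move=> kn; pose s := [seq walk_ffun n w | w <- saws dirs n & P (nth (0 : V) w k)].
have -> : (SAW d n `&` [set g | P (g (inord k))])%classic = [set` [fset g in s]%fset]%classic.
  apply/seteqP; split=> g /=.
    move=> [/SAW_walk_ffun[w ws ->]] /=; rewrite walk_ffun_inord // => Pw.
    by rewrite !inE; apply: map_f; rewrite mem_filter Pw.
  rewrite !inE => /mapP[w]; rewrite mem_filter => /andP[Pw ws] ->.
  by split; [exact: walk_ffun_SAW | rewrite /= walk_ffun_inord].
rewrite set_fsetK card_fseq undup_id ?size_map ?size_filter //.
rewrite map_inj_in_uniq; first by rewrite filter_uniq // uniq_saws // uniq_unit_vectors.
move=> w1 w2; rewrite mem_filter => /andP[_]; rewrite mem_saws => /and3P[s1 _ _].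
rewrite mem_filter => /andP[_]; rewrite mem_saws => /and3P[s2 _ _].
exact: walk_ffun_inj.
Qed.

Lemma P_SAW_count n (x : V) k : (k <= n)%N ->
  P_SAW R [set g : {ffun 'I_n.+1 -> V} | g (inord k) = x]%classic =
  (count (fun w => nth (0 : V) w k == x) (saws dirs n))%:R / (cn dirs n)%:R.
Proof.
move=> kn; rewrite /P_SAW /uniform_law; congr (_%:R / _%:R).
  rewrite -(card_SAW (fun v => v == x) kn); congr #|` fset_set _|.
  by congr (_ `&` _)%classic; apply/seteqP; split=> g /= /eqP.
rewrite /cn -(count_predT (saws dirs n)) -(card_SAW (fun=> true) kn).
by congr #|` fset_set _|; apply/seteqP; split=> g; [move=> h; split | case].
Qed.

Lemma cn_unit_gt0 n : (0 < cn dirs n)%N.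
Proof.
have [g /SAW_walk_ffun[w ws _]] := SAW_nonempty n (ltnW d2).
by rewrite /cn; case: (saws dirs n) ws.
Qed.

Lemma sqrt_nat n : exists T, (T * T <= n < T.+1 * T.+1)%N.
Proof.
elim: n => [|n [T /andP[le lt]]]; first by exists 0%N.
case: (leqP (T.+1 * T.+1) n.+1) => h; last by exists T; rewrite h (leq_trans le).
by exists T.+1; rewrite h /=; apply: leq_ltn_trans lt _; rewrite ltn_mul.
Qed.

Lemma midpoint_probability : exists C : R, 0 < C /\ forall n, (0 < n)%N ->
  forall x : V, P_SAW R [set g : {ffun 'I_n.+1 -> V} | g (inord n./2) = x]%classic <=
    C / Num.sqrt n%:R.
Proof.
have [C [n0 [C0 H]]] := midpoint_bound R (@unit_vectorsN d) (unit_vectors0 d)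
  (uniq_unit_vectors d) (unit_vectors_rungs d2) cn_unit_gt0.
(* For [n < n0] the probability is at most 1 and [sqrt n <= n0]. From [n0] on, [T] is the integer
   part of [sqrt n], and [sqrt n <= T + 1 <= 2 * T]. *)
exists (2 * C + n0%:R); split; first by rewrite ltr_wpDr // mulr_gt0.
move=> n n1 x; rewrite P_SAW_count; last by clear; lia.
have cR : 0 < (cn dirs n)%:R :> R by rewrite ltr0n cn_unit_gt0.
have nR : 0 < n%:R :> R by rewrite ltr0n.
have sR : 0 < Num.sqrt n%:R :> R by rewrite sqrtr_gt0.
have ss : Num.sqrt n%:R * Num.sqrt n%:R = n%:R :> R.
  by rewrite -expr2 sqr_sqrtr // ltW.
rewrite ler_pdivrMr // mulrAC ler_pdivlMr //.
set N := count _ _.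
case: (leqP n0 n) => nn0; last first.
  have Ncn : N%:R <= (cn dirs n)%:R :> R by rewrite ler_nat count_size.
  have s1 : Num.sqrt n%:R <= n%:R :> R.
    rewrite -[leRHS]ss ler_peMl ?(ltW sR) // -[leLHS]sqrtr1 ler_sqrt //.
    by rewrite ler1n.
  have s2 : n%:R <= n0%:R :> R by rewrite ler_nat ltnW.
  have s3 : Num.sqrt n%:R <= 2 * C + n0%:R :> R.
    apply: le_trans s1 _; apply: le_trans s2 _; rewrite lerDr mulr_ge0 // ltW //.
  by rewrite mulrC; exact: (ler_pM (ltW sR) (ler0n _ _) s3 Ncn).
have [T /andP[TT nT]] := sqrt_nat n.
have T1 : (0 < T)%N by move: nT n1; clear; case: T => //; lia.
have sT : Num.sqrt n%:R <= 2 * T%:R :> R.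
  rewrite -(ler_sqr (x := Num.sqrt _)) ?nnegrE ?(ltW sR) ?mulr_ge0 //.
  rewrite expr2 ss expr2 -!natrM ler_nat; move: nT T1; clear; nia.
have := H n T nn0 TT x; rewrite -/N => HT.
have : N%:R * Num.sqrt n%:R <= N%:R * (2 * T%:R) :> R by rewrite ler_wpM2l.
have : 0 <= n0%:R * (cn dirs n)%:R :> R by rewrite mulr_ge0.
nra.
Qed.

End Translation.

Unset Implicit Arguments.
Local Open Scope classical_set_scope.
Local Open Scope ring_scope.

Theorem proposition1p3 (R : realType) (d : nat) (hd : (2 <= d)%N) :
  exists C : R, 0 < C /\
    forall n : nat, (0 < n)%N ->
      (ereal_sup [set (P_SAW R [set g : {ffun 'I_n.+1 -> 'rV[int]_d} |
                                 g (inord n./2) = x])%:E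
                 | x in [set: 'rV[int]_d]]
        <= (C * n%:R `^ (- 2^-1))%:E)%E.
Proof.
have [C [C0 bound]] := midpoint_probability R hd.
exists C; split => // n n0; apply: ge_ereal_sup => _ [x _ <-].
by rewrite lee_fin powRN powR12_sqrt //; exact: (bound n n0 x).
Qed.
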